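(* Let $Q\subset\mathbb{R}^2$ be the regular hexagon of unit width (euclidean distance $1$ between opposite sides), and let $K$ be any $Q$-cover. Then $\operatorname{area}K\ge\operatorname{area}K_0=\frac{1}{2\operatorname{area}Q}$, where $K_0$ is the regular triangle of unit height whose sides are parallel to sides of $Q$.
   Context: For $x\in\mathbb{R}^2$ let $\|x\|_Q=\max_{y\in Q}\langle x,y\rangle$ (one may take $Q$ centered at the origin). A non-degenerate triangle is $Q$-normal if its boundary can be oriented $u\to v\to w\to u$ so that the directions of $v-u$, $w-v$, $u-w$ are outward normal directions of sides of $Q$ and $\|v-u\|_Q+\|w-v\|_Q+\|u-w\|_Q=1$; a segment $[u,v]$ is $Q$-normal if the directions of $v-u$ and $u-v$ are outward normal directions of sides of $Q$ and $\|v-u\|_Q+\|u-v\|_Q=1$. A set $A$ fits into $B$ if $A+t\subset B$ for some $t$. A $Q$-cover is a convex shape (compact convex set with non-empty interior) into which every $Q$-normal triangle (degenerate or not) fits. *)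

(* Defs.v *)
From HB Require Import structures.
From mathcomp Require Import all_boot all_order all_algebra.
From mathcomp Require Import all_classical all_reals all_analysis.
Set Implicit Arguments. Unset Strict Implicit. Unset Printing Implicit Defensive.
Import Order.TTheory GRing.Theory Num.Theory.
Import numFieldNormedType.Exports.
Local Open Scope classical_set_scope.
Local Open Scope ring_scope.

Section Plane.
Variable R : realType.
Local Notation P := (R * R)%type.

Definition padd (x y : P) : P := (x.1 + y.1, x.2 + y.2).
Definition psub (x y : P) : P := (x.1 - y.1, x.2 - y.2).
Definition pscale (t : R) (x : P) : P := (t * x.1, t * x.2).
Definition dot (x y : P) : R := x.1 * y.1 + x.2 * y.2.
Definition cross (x y : P) : R := x.1 * y.2 - x.2 * y.1.

Definition area (A : set P) : \bar R :=
  ((@lebesgue_measure R) \x (@lebesgue_measure R))%E A.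

(* The six outward unit normals of the sides of the regular hexagon Q:
   the unit vectors at angles k*pi/3, k = 0..5. *)
Definition hexnormal (k : 'I_6) : P :=
  match val k with
  | 0 => (1, 0)
  | 1 => (1/2, Num.sqrt 3 / 2)
  | 2 => (-(1/2), Num.sqrt 3 / 2)
  | 3 => (-1, 0)
  | 4 => (-(1/2), -(Num.sqrt 3 / 2))
  | _ => (1/2, -(Num.sqrt 3 / 2))
  end.

(* Q : the regular hexagon of unit width centred at the origin
   (each side at euclidean distance 1/2 from the origin). *)
Definition hexQ : set P := [set x | forall k : 'I_6, dot x (hexnormal k) <= 1/2].

Definition normQ (x : P) : R := sup [set dot x y | y in hexQ].

Definition normal_dir (d : P) : Prop :=
  exists (k : 'I_6) (t : R), 0 < t /\ d = pscale t (hexnormal k).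

Definition seg (u v : P) : set P :=
  [set z | exists a b : R, [/\ 0 <= a, 0 <= b, a + b = 1 &
      z = padd (pscale a u) (pscale b v)]].
Definition tri (u v w : P) : set P :=
  [set z | exists a b c : R, [/\ 0 <= a, 0 <= b, 0 <= c, a + b + c = 1 &
      z = padd (padd (pscale a u) (pscale b v)) (pscale c w)]].

Definition Qnormal_triangle (T : set P) : Prop :=
  exists u v w : P,
    [/\ cross (psub v u) (psub w u) != 0 /\ T = tri u v w,
        normal_dir (psub v u), normal_dir (psub w v), normal_dir (psub u w) &
        normQ (psub v u) + normQ (psub w v) + normQ (psub u w) = 1].

(* Q-normal segment (= degenerate Q-normal triangle) *)
Definition Qnormal_segment (T : set P) : Prop :=
  exists u v : P,
    [/\ T = seg u v,
        normal_dir (psub v u), normal_dir (psub u v) &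
        normQ (psub v u) + normQ (psub u v) = 1].

Definition fits (A B : set P) : Prop :=
  exists t : P, forall x, A x -> B (padd x t).

Definition convex_set (K : set P) : Prop :=
  forall x y, K x -> K y -> forall l : R, 0 <= l <= 1 ->
    K (padd (pscale l x) (pscale (1 - l) y)).

Definition convex_shape (K : set P) : Prop :=
  [/\ convex_set K, compact K & (K°) !=set0].

Definition Qcover (K : set P) : Prop :=
  convex_shape K /\
  (forall T, Qnormal_triangle T \/ Qnormal_segment T -> fits T K).

(* K0 : regular triangle of unit height (inradius 1/3) with sides parallel
   to the sides of Q (outward normals at angles 0, 2pi/3, 4pi/3). *)
Definition K0 : set P :=
  [set x | forall k : 'I_6, ~~ odd (val k) -> dot x (hexnormal k) <= 1/3].

End Plane.

(* Main.v *)
(* In the lattice coordinates of two adjacent hexagon normals, put p = x, q = y,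
   r = - x - y.  A cover contains unit segments parallel to the three axes and the two
   triangles of side 2/3; the bound to prove is area 2/3 in lattice units.  Up to a
   point reflection, the lines q = 0, p = 0, x + y = d of the segments satisfy d >= 0, and
   only the triangle D with sides on p = x0, q = y0, x + y = x0 + y0 - 2/3 is used.
   - The mixed area with D gives area >= (max p + max q + max r) / 3, so this sum may be
     assumed smaller than 2.  Then the segments cross each other pairwise: their offsets
     y1, y2, y3 lie in (0, m), with m = 1 - d and m < y1 + y2 + y3 < 2 m.
   - If D is contained in none of the half-planes p < 0, q < 0, x + y > d, the polygon
     through the corners of D and the six endpoints has a signed area that does not depend
     on the position of D, namely
     2/3 + (m/3 - m^2 + m (y1 + y2 + y3) - (y1 y2 + y2 y3 + y3 y1)) / 2 >= 2/3.
   - Otherwise D lies on one side of a segment; either that segment is a chord of K of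
     length 1 with total height at least 4/3 over it, or the hexagon of the six endpoints
     already has area at least 2/3. *)

Require Import Defs.
From HB Require Import structures.
From mathcomp Require Import all_boot all_order all_algebra.
From mathcomp Require Import all_classical all_reals all_analysis.
From mathcomp Require Import measurable_realfun ring lra.
Import Order.TTheory GRing.Theory Num.Theory.
Import numFieldNormedType.Exports.
Local Open Scope classical_set_scope.
Local Open Scope ring_scope.

(** * Areas of planar regions by vertical sections *)

Lemma integral_affine (R : realType) (a b x0 x1 : R) : x0 <= x1 ->
  (\int[lebesgue_measure]_(x in `[x0, x1]) (a + b * x)%:E)%E =
  (a * (x1 - x0) + b * (x1 ^+ 2 - x0 ^+ 2) / 2)%:E.
Proof.
rewrite le_eqVlt => /predU1P[->|lt01].
  rewrite set_itv1 integral_set1; congr EFin; ring.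
pose F x := a * x + b / 2 * x ^+ 2.
have dF (x : R) : is_derive x 1 F (a + b * x).
  rewrite /F; apply: is_derive_eq.
  by rewrite /GRing.scale /=; field.
have cF x : {for x, continuous F}.
  by apply/differentiable_continuous/derivable1_diffP; exact: ex_derive.
rewrite (@continuous_FTC2 R (fun x => a + b * x) F) //.
- by rewrite /F -EFinB; congr EFin; field.
- apply: continuous_subspaceT => x.
  apply: cvgD; first exact: cvg_cst.
  by apply: cvgM; [exact: cvg_cst | exact: cvg_id].
- split => [x _||]; first exact: ex_derive.
  + by apply: cvg_at_right_filter; exact: cF.
  + by apply: cvg_at_left_filter; exact: cF.
- by move=> x _; rewrite derive1E; exact: derive_val.
Qed.

(** A nonnegative integral is a supremum over the simple functions below the integrand, and a larger
    integrand has more of them. In this generality it applies to the section lengths in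
    [le_area]. *)
Lemma ge0_le_integralT d (T : measurableType d) (R : realType)
    (mu : {measure set T -> \bar R}) (f g : T -> \bar R) :
  (forall x, 0 <= f x)%E -> (forall x, f x <= g x)%E ->
  (\int[mu]_x f x <= \int[mu]_x g x)%E.
Proof.
move=> f0 fg.
have g0 x : (0 <= g x)%E by exact: le_trans (f0 x) (fg x).
rewrite !ge0_integralTE//; apply: le_ereal_sup => _ [h hf <-].
by exists h => // x; exact: le_trans (hf x) (fg x).
Qed.

(** The area integrates the lengths of the vertical sections. The sections of [K] are closed, hence
    measurable, and contain those of [A]. *)
Lemma le_area (R : realType) (A K : set (R * R)) :
  measurable A -> closed K -> A `<=` K -> (area A <= area K)%E.
Proof.
move=> mA cK AK; rewrite /area /product_measure1.
apply: ge0_le_integralT => x /=; first exact: measure_ge0.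
apply: le_measure; rewrite ?inE.
- exact: measurable_xsection.
- apply: closed_measurable.
  rewrite (_ : xsection K x = (fun y => (x, y)) @^-1` K); last first.
    by apply/seteqP; split => y /=; rewrite /xsection /= inE.
  apply: preimage_closed => // y _.
  by apply: (cvg_pair (F := nbhs y) (G := nbhs x) (H := nbhs y)
    (cvg_cst x) (cvg_id (F := nbhs y))).
- by move=> y; rewrite /xsection /= !inE; exact: AK.
Qed.

(* The sections are only constrained off the endpoints, so one lemma serves
   open and closed regions alike. *)
Lemma area_affine_sections (R : realType) (A : set (R * R)) (a b x0 x1 : R) :
  x0 <= x1 -> measurable A -> (forall z, A z -> x0 <= z.1 <= x1) ->
  (forall x, x0 < x < x1 ->
    lebesgue_measure (xsection A x) = (a + b * x)%:E) ->
  area A = (a * (x1 - x0) + b * (x1 ^+ 2 - x0 ^+ 2) / 2)%:E.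
Proof.
move=> le01 mA Ax hA; rewrite /area /product_measure1 -integral_affine //.
have mf : measurable_fun setT (lebesgue_measure \o xsection A : R -> \bar R).
  exact: measurable_fun_xsection.
rewrite (_ : \int[lebesgue_measure]_x _ =
   \int[lebesgue_measure]_(x in `[x0, x1]) (lebesgue_measure \o xsection A) x)%E.
  rewrite integral_itv_bndoo; last exact: measurable_funTS.
  rewrite [RHS]integral_itv_bndoo; last first.
    apply: measurable_funTS; apply/measurable_EFinP.
    apply: measurable_funD => //; exact: measurable_funM.
  by apply: eq_integral => x; rewrite inE /= in_itv /= => /hA.
rewrite [RHS]integral_mkcond; apply: eq_integral => x _.
rewrite patchE; case: ifPn => // /negP xn /=.
rewrite (_ : xsection A x = set0) ?measure0 //.
apply/seteqP; split => y //=; rewrite /xsection /= inE => /Ax /= xx.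
by apply: xn; rewrite inE /= in_itv.
Qed.

Lemma measurable_affine (R : realType) (a b c : R) :
  measurable_fun setT (fun z : R * R => a + b * z.1 + c * z.2).
Proof.
apply: measurable_funD; first apply: measurable_funD => //.
- by apply: measurable_funM => //; exact: measurable_fst.
- by apply: measurable_funM => //; exact: measurable_snd.
Qed.

Lemma measurable_halfplane_gt0 (R : realType) (a b c : R) :
  measurable [set z : R * R | 0 < a + b * z.1 + c * z.2].
Proof.
rewrite (_ : [set _ | _] =
    setT `&` (fun z : R * R => a + b * z.1 + c * z.2) @^-1` `]0, +oo[).
  by apply: measurable_affine => //; exact: measurable_itv.
by rewrite setTI; apply/seteqP; split => z /=; rewrite in_itv /= andbT.
Qed.

Lemma measurable_halfplane_ge0 (R : realType) (a b c : R) :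
  measurable [set z : R * R | 0 <= a + b * z.1 + c * z.2].
Proof.
rewrite (_ : [set _ | _] =
    setT `&` (fun z : R * R => a + b * z.1 + c * z.2) @^-1` `[0, +oo[).
  by apply: measurable_affine => //; exact: measurable_itv.
by rewrite setTI; apply/seteqP; split => z /=; rewrite in_itv /= andbT.
Qed.

(** * Area of open triangles *)

(** Counterclockwise orientation is built in: the three cross products add up to
    [cross (psub v u) (psub w u)], so the set is empty unless this is positive. *)
Definition opentri {R : realType} (u v w : R * R) : set (R * R) :=
  [set z | [/\ 0 < cross (psub v u) (psub z u), 0 < cross (psub w v) (psub z v)
             & 0 < cross (psub u w) (psub z w)]].

Lemma opentri_rot (R : realType) (u v w : R * R) : opentri v w u = opentri u v w.
Proof. by apply/seteqP; split => z [? ? ?]; split. Qed.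

Lemma measurable_opentri (R : realType) (u v w : R * R) :
  measurable (opentri u v w).
Proof.
pose h (u v : R * R) := [set z : R * R | 0 < (u.1 * (v.2 - u.2) - u.2 * (v.1 - u.1))
    + (u.2 - v.2) * z.1 + (v.1 - u.1) * z.2].
have hE (a b z : R * R) : h a b z = (0 < cross (psub b a) (psub z a)) :> Prop.
  rewrite /h /= /cross /psub /=; congr (is_true (0 < _)); ring.
rewrite (_ : opentri u v w = h u v `&` h v w `&` h w u).
  by apply: measurableI; [apply: measurableI|]; exact: measurable_halfplane_gt0.
apply/seteqP; split => z; rewrite /opentri /= !hE; first by move=> [].
by move=> [[]].
Qed.

Definition slab {R : realType} (x0 x1 a b a' b' : R) : set (R * R) :=
  [set z | [/\ x0 < z.1, z.1 < x1, a + b * z.1 < z.2 & z.2 < a' + b' * z.1]].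

Lemma measurable_slab (R : realType) (x0 x1 a b a' b' : R) :
  measurable (slab x0 x1 a b a' b').
Proof.
rewrite (_ : slab _ _ _ _ _ _ =
  [set z | 0 < - x0 + 1 * z.1 + 0 * z.2] `&`
  [set z | 0 < x1 + (-1) * z.1 + 0 * z.2] `&`
  ([set z | 0 < - a + (- b) * z.1 + 1 * z.2] `&`
   [set z | 0 < a' + b' * z.1 + (-1) * z.2])).
  by apply: measurableI; apply: measurableI; exact: measurable_halfplane_gt0.
apply/seteqP; split => z; rewrite /slab /=.
  by move=> [? ? ? ?]; do ![split]; lra.
by move=> [[? ?] [? ?]]; split; lra.
Qed.

Lemma area_slab (R : realType) (x0 x1 a b a' b' : R) : x0 <= x1 ->
  (forall x, x0 < x < x1 -> a + b * x <= a' + b' * x) ->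
  area (slab x0 x1 a b a' b') =
  ((a' - a) * (x1 - x0) + (b' - b) * (x1 ^+ 2 - x0 ^+ 2) / 2)%:E.
Proof.
move=> le01 ab; apply: area_affine_sections => //.
- exact: measurable_slab.
- by move=> z [? ? _ _]; apply/andP; split; exact: ltW.
move=> x xx; have /andP[x0x xx1] := xx.
rewrite (_ : xsection _ _ = `]a + b * x, a' + b' * x[%classic); last first.
  apply/seteqP; split => y; rewrite /xsection /slab /= inE /= in_itv /=.
    by move=> [_ _ -> ->].
  by move=> /andP[? ?].
rewrite lebesgue_measure_itv /= lte_fin; case: ltP => [_|h].
  by rewrite -EFinB; congr EFin; ring.
by congr EFin; have := ab _ xx; lra.
Qed.


(** The slab is a triangle with apex [(x0, y)], two sides of slopes [s] and [t], and a vertical side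
    of length [(t - s) * (x1 - x0)]. *)
Lemma area_fan_right (R : realType) (x0 x1 y s t : R) : x0 <= x1 -> s <= t ->
  area (slab x0 x1 (y - s * x0) s (y - t * x0) t) =
  ((t - s) * (x1 - x0) ^+ 2 / 2)%:E.
Proof.
move=> le01 st; rewrite area_slab //; first by congr EFin; field.
by move=> x /andP[? ?]; nra.
Qed.

(** Here the apex is [(x1, y)]; to its left the line of larger slope runs below. *)
Lemma area_fan_left (R : realType) (x0 x1 y s t : R) : x0 <= x1 -> s <= t ->
  area (slab x0 x1 (y - t * x1) t (y - s * x1) s) =
  ((t - s) * (x1 - x0) ^+ 2 / 2)%:E.
Proof.
move=> le01 st; rewrite area_slab //; first by congr EFin; field.
by move=> x /andP[? ?]; nra.
Qed.

Lemma le_area_two (R : realType) (T S1 S2 : set (R * R)) (r1 r2 xm : R) :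
  measurable T -> measurable S1 -> measurable S2 -> S1 `<=` T -> S2 `<=` T ->
  (forall z, S1 z -> z.1 < xm) -> (forall z, S2 z -> xm < z.1) ->
  area S1 = r1%:E -> area S2 = r2%:E -> ((r1 + r2)%:E <= area T)%E.
Proof.
move=> mT m1 m2 s1 s2 l1 l2 a1 a2; rewrite EFinD -a1 -a2 /area -measureU //.
  apply: le_measure; rewrite ?inE //; first exact: measurableU.
  by move=> z [/s1|/s2].
by apply/seteqP; split => z //= -[/l1 + /l2]; lra.
Qed.


(** The vertical line through the vertex of middle abscissa cuts the triangle into two fans over a
    common vertical base. The cases differ in which of [v] and [w] is that vertex. *)
Lemma area_opentri_leftmost (R : realType) (u v w : R * R) :
  u.1 <= v.1 -> u.1 <= w.1 -> 0 < cross (psub v u) (psub w u) ->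
  ((cross (psub v u) (psub w u) / 2)%:E <= area (opentri u v w))%E.
Proof.
case: u v w => [x y] [x' y'] [x'' y'']; rewrite /cross /psub /= => uv uw.
have [vw|wv] := leP x' x''.
(* From here on [v = u + (a, p)] and [w = u + (a + b, q)]. *)
- move: (subrKC x x') (subrKC x' x'') (subrKC y y') (subrKC y y'').
  have : 0 <= x' - x by lra.
  have : 0 <= x'' - x' by lra.
  move: (x' - x) (x'' - x') (y' - y) (y'' - y) => a b p q b0 a0.
  move=> /esym ? /esym ? /esym ? /esym ?; subst x'' y' y''; subst x'.
  move=> {uv uw vw}.
  rewrite (_ : _ - _ = a * q - p * (a + b)); last by ring.
  move=> D0.
  set T := opentri _ _ _; have mT : measurable T by exact: measurable_opentri.
  have TE z : T z = [/\ 0 < a * (z.2 - y) - p * (z.1 - x),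
     0 < b * (z.2 - (y + p)) - (q - p) * (z.1 - (x + a)) &
     0 < (a + b) * (y - z.2) + q * (z.1 - x)] :> Prop.
    rewrite /T /opentri /= /cross /psub /=.
    by congr and3; congr (is_true (0 < _)); ring.
  have ab0 : 0 < a + b.
    rewrite ltNge; apply/negP => ab; have [az bz] : a = 0 /\ b = 0 by lra.
    by move: D0; rewrite az bz; lra.
  (* [t] is the slope of the long side, so [t * a - p] is the length of the vertical chord through
     [v], the common base of the fans. *)
  pose t := q / (a + b).
  have qE : q = t * (a + b) by rewrite /t divfK // gt_eqF.
  have l0 : 0 < t * a - p by rewrite qE in D0; nra.
  have [S1 [mS1 S1T S1l aS1]] : exists S1 : set (R * R), [/\ measurable S1, S1 `<=` T,
      forall z, S1 z -> z.1 < x + a & area S1 = ((t * a - p) * a / 2)%:E].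
    (* For [a = 0] the side from [u] to [v] is vertical and the left fan is empty. *)
    move: a0; rewrite le_eqVlt => /predU1P[<-|a0].
      by exists set0; split => //; rewrite mulr0 mul0r /area measure0.
    have [s ps] : exists s, p = s * a by exists (p / a); rewrite divfK // gt_eqF.
    have st : s < t by rewrite ps in l0; nra.
    exists (slab x (x + a) (y - s * x) s (y - t * x) t); split.
    - exact: measurable_slab.
    - move=> [z1 z2] [/= h1 h2 h3 h4]; rewrite TE /=.
      have k1 : 0 < a * (z2 - y) - p * (z1 - x) by rewrite ps; nra.
      split => //; last by rewrite qE; nra.
      (* Left of the chord the side from [v] to [w] is respected automatically: its inequality times
         [a] is a nonnegative combination of [k1] and the distance to the chord. *)
      rewrite -(pmulr_rgt0 _ a0).
      rewrite (_ : a * _ = b * (a * (z2 - y) - p * (z1 - x)) +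
        (a * q - p * (a + b)) * (x + a - z1)); last by ring.
      by apply: ltr_wpDl; [apply: mulr_ge0 => //; exact: ltW | apply: mulr_gt0; lra].
    - by move=> [z1 z2] [].
    - rewrite area_fan_right; [|lra|lra]; congr EFin; rewrite ps; ring.
  have [S2 [mS2 S2T S2l aS2]] : exists S2 : set (R * R), [/\ measurable S2, S2 `<=` T,
      forall z, S2 z -> x + a < z.1 & area S2 = ((t * a - p) * b / 2)%:E].
    move: b0; rewrite le_eqVlt => /predU1P[<-|b0].
      by exists set0; split => //; rewrite mulr0 mul0r /area measure0.
    have [r pr] : exists r, q - p = r * b by exists ((q - p) / b); rewrite divfK // gt_eqF.
    have rt : t < r by rewrite qE in pr; nra.
    exists (slab (x + a) (x + a + b) (y + q - r * (x + a + b)) r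
       (y + q - t * (x + a + b)) t); split.
    - exact: measurable_slab.
    - move=> [z1 z2] [/= h1 h2 h3 h4]; rewrite TE /=.
      have k1 : 0 < b * (z2 - (y + p)) - (q - p) * (z1 - (x + a)).
        have pE : p = q - r * b by lra.
        by rewrite pr pE; nra.
      split => //; last by rewrite qE; rewrite qE in h4; nra.
      rewrite -(pmulr_rgt0 _ b0).
      rewrite (_ : b * _ = a * (b * (z2 - (y + p)) - (q - p) * (z1 - (x + a))) +
        (a * q - p * (a + b)) * (z1 - (x + a))); last by ring.
      by apply: ltr_wpDl; [apply: mulr_ge0 => //; exact: ltW | apply: mulr_gt0; lra].
    - by move=> [z1 z2] [].
    - rewrite area_fan_left; [|lra|lra]; congr EFin.
      rewrite (_ : x + a + b - (x + a) = b); last by ring.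
      rewrite expr2 mulrA mulrBl -pr qE; ring.
  have := le_area_two _ _ _ _ _ _ _ mT mS1 mS2 S1T S2T S1l S2l aS1 aS2.
  by congr (_ <= _)%E; congr EFin; rewrite qE; ring.
(* Mirror image: [w = u + (a, p)] is in the middle and the long side ends at
   [v = u + (a + b, q)]. *)
- move: (subrKC x x'') (subrKC x'' x') (subrKC y y'') (subrKC y y').
  have : 0 <= x'' - x by lra.
  have : 0 <= x' - x'' by lra.
  move: (x'' - x) (x' - x'') (y'' - y) (y' - y) => a b p q b0 a0.
  move=> /esym ? /esym ? /esym ? /esym ?; subst x' y' y''; subst x''.
  move=> {uv uw wv}.
  rewrite (_ : _ - _ = (a + b) * p - q * a); last by ring.
  move=> D0.
  set T := opentri _ _ _; have mT : measurable T by exact: measurable_opentri.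
  have TE z : T z = [/\ 0 < (a + b) * (z.2 - y) - q * (z.1 - x),
     0 < b * (y + p - z.2) + (q - p) * (z.1 - (x + a)) &
     0 < a * (y - z.2) + p * (z.1 - x)] :> Prop.
    rewrite /T /opentri /= /cross /psub /=.
    by congr and3; congr (is_true (0 < _)); ring.
  have ab0 : 0 < a + b.
    rewrite ltNge; apply/negP => ab; have [az bz] : a = 0 /\ b = 0 by lra.
    by move: D0; rewrite az bz; lra.
  pose t := q / (a + b).
  have qE : q = t * (a + b) by rewrite /t divfK // gt_eqF.
  have l0 : 0 < p - t * a by rewrite qE in D0; nra.
  have [S1 [mS1 S1T S1l aS1]] : exists S1 : set (R * R), [/\ measurable S1, S1 `<=` T,
      forall z, S1 z -> z.1 < x + a & area S1 = ((p - t * a) * a / 2)%:E].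
    move: a0; rewrite le_eqVlt => /predU1P[<-|a0].
      by exists set0; split => //; rewrite mulr0 mul0r /area measure0.
    have [s ps] : exists s, p = s * a by exists (p / a); rewrite divfK // gt_eqF.
    have st : t < s by rewrite ps in l0; nra.
    exists (slab x (x + a) (y - t * x) t (y - s * x) s); split.
    - exact: measurable_slab.
    - move=> [z1 z2] [/= h1 h2 h3 h4]; rewrite TE /=.
      have k1 : 0 < a * (y - z2) + p * (z1 - x) by rewrite ps; nra.
      split => //; first by rewrite qE; nra.
      rewrite -(pmulr_rgt0 _ a0).
      rewrite (_ : a * _ = b * (a * (y - z2) + p * (z1 - x)) +
        ((a + b) * p - q * a) * (x + a - z1)); last by ring.
      by apply: ltr_wpDl; [apply: mulr_ge0 => //; exact: ltW | apply: mulr_gt0; lra].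
    - by move=> [z1 z2] [].
    - rewrite area_fan_right; [|lra|lra]; congr EFin; rewrite ps; ring.
  have [S2 [mS2 S2T S2l aS2]] : exists S2 : set (R * R), [/\ measurable S2, S2 `<=` T,
      forall z, S2 z -> x + a < z.1 & area S2 = ((p - t * a) * b / 2)%:E].
    move: b0; rewrite le_eqVlt => /predU1P[<-|b0].
      by exists set0; split => //; rewrite mulr0 mul0r /area measure0.
    have [r pr] : exists r, q - p = r * b by exists ((q - p) / b); rewrite divfK // gt_eqF.
    have rt : r < t by rewrite qE in pr; nra.
    exists (slab (x + a) (x + a + b) (y + q - t * (x + a + b)) t
       (y + q - r * (x + a + b)) r); split.
    - exact: measurable_slab.
    - move=> [z1 z2] [/= h1 h2 h3 h4]; rewrite TE /=.
      have k1 : 0 < b * (y + p - z2) + (q - p) * (z1 - (x + a)).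
        have pE : p = q - r * b by lra.
        by rewrite pr pE; nra.
      split => //; first by rewrite qE; rewrite qE in h3; nra.
      rewrite -(pmulr_rgt0 _ b0).
      rewrite (_ : b * _ = a * (b * (y + p - z2) + (q - p) * (z1 - (x + a))) +
        ((a + b) * p - q * a) * (z1 - (x + a))); last by ring.
      by apply: ltr_wpDl; [apply: mulr_ge0 => //; exact: ltW | apply: mulr_gt0; lra].
    - by move=> [z1 z2] [].
    - rewrite area_fan_left; [|lra|lra]; congr EFin.
      rewrite (_ : x + a + b - (x + a) = b); last by ring.
      rewrite expr2 mulrA mulrBl -pr qE; ring.
  have := le_area_two _ _ _ _ _ _ _ mT mS1 mS2 S1T S2T S1l S2l aS1 aS2.
  by congr (_ <= _)%E; congr EFin; rewrite qE; ring.
Qed.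

(** The bound is trivial for nonpositive orientation; otherwise a cyclic relabelling puts the
    leftmost vertex first. *)
Lemma area_opentri (R : realType) (u v w : R * R) :
  ((cross (psub v u) (psub w u) / 2)%:E <= area (opentri u v w))%E.
Proof.
have [D0|D0] := leP (cross (psub v u) (psub w u)) 0.
  by apply: (@le_trans _ _ 0%E); [rewrite lee_fin; lra | exact: measure_ge0].
pose P (u v w : R * R) := 0 < cross (psub v u) (psub w u) ->
  ((cross (psub v u) (psub w u) / 2)%:E <= area (opentri u v w))%E.
have rot (p q r : R * R) : P q r p -> P p q r.
  rewrite /P opentri_rot (_ : cross (psub r q) _ = cross (psub q p) (psub r p)) //.
  by rewrite /cross /psub /=; ring.
suff : P u v w by apply.
have [uv|vu] := leP u.1 v.1; have [uw|wu] := leP u.1 w.1.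
- exact: area_opentri_leftmost.
- by apply/rot/rot/area_opentri_leftmost; lra.
- by apply/rot/area_opentri_leftmost; lra.
- have [vw|wv] := leP v.1 w.1; first by apply/rot/area_opentri_leftmost; lra.
  by apply/rot/rot/area_opentri_leftmost; lra.
Qed.

(** * Areas of the regular triangle and of the hexagon *)

Lemma in_symmetric_itv (R : realType) (c h y : R) : 0 < h ->
  (y \in `[- (c / h), c / h]) = (- c <= h * y <= c).
Proof.
by move=> h0; rewrite in_itv /= -mulNr ler_pdivrMr // ler_pdivlMr // [y * h]mulrC.
Qed.

(** By [K0E] the triangle has the vertex [(- 2 / 3, 0)] and a vertical side on [z.1 = 1 / 3], so the
    section length grows linearly from [0] to [2 / h]. *)
Lemma area_K0 (R : realType) : area (@K0 R) = (Num.sqrt 3)^-1%:E.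
Proof.
pose h : R := Num.sqrt 3; have h2 : h ^+ 2 = 3 by rewrite sqr_sqrtr.
have h0 : 0 < h by rewrite sqrtr_gt0.
have K0E : @K0 R = [set z | [/\ z.1 <= 1 / 3,
    h * z.2 <= 2 / 3 + z.1 & - (2 / 3 + z.1) <= h * z.2]].
  apply/seteqP; split => z.
    move=> hz.
    have := hz (@Ordinal 6 0 isT) isT; have := hz (@Ordinal 6 2 isT) isT.
    have := hz (@Ordinal 6 4 isT) isT.
    by rewrite /hexnormal /dot /= -/h => ? ? ?; split; lra.
  move=> [a b c] [[|[|[|[|[|[|//]]]]]] i] //= _; rewrite /hexnormal /dot /= -/h; lra.
rewrite (@area_affine_sections _ _ (4 / 3 / h) (2 / h) (- (2 / 3)) (1 / 3)).
- by rewrite -/h; congr EFin; field; rewrite gt_eqF.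
- lra.
- rewrite K0E (_ : [set _ | _] =
    [set z | 0 <= 1 / 3 + (-1) * z.1 + 0 * z.2] `&`
    [set z | 0 <= 2 / 3 + 1 * z.1 + (- h) * z.2] `&`
    [set z | 0 <= 2 / 3 + 1 * z.1 + h * z.2]).
    by apply: measurableI; [apply: measurableI|]; exact: measurable_halfplane_ge0.
  apply/seteqP; split => z /=; first by move=> [? ? ?]; do ![split]; lra.
  by move=> [[? ?] ?]; split; lra.
- by move=> z; rewrite K0E => -[? ? ?]; apply/andP; split; lra.
move=> x /andP[x0 x1].
rewrite (_ : xsection _ _ = `[- ((2 / 3 + x) / h), (2 / 3 + x) / h]%classic); last first.
  apply/seteqP; split => y; rewrite /xsection K0E /= inE /= in_symmetric_itv //.
    by move=> [_ ? ?]; apply/andP.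
  by move=> /andP[? ?]; split; lra.
rewrite lebesgue_measure_itv /= lte_fin ifT; last first.
  by have : 0 < (2 / 3 + x) / h; [apply: divr_gt0; lra | lra].
by rewrite -EFinB; congr EFin; field; rewrite gt_eqF.
Qed.

(* The hexagon is cut along the line [z.1 = 0]. *)
Lemma area_hexQ (R : realType) : area (@hexQ R) = (Num.sqrt 3 / 2)%:E.
Proof.
pose h : R := Num.sqrt 3; have h2 : h ^+ 2 = 3 by rewrite sqr_sqrtr.
have h0 : 0 < h by rewrite sqrtr_gt0.
have QE : @hexQ R = [set z | [/\ - (1 / 2) <= z.1, z.1 <= 1 / 2,
    h * z.2 <= 1 - z.1, h * z.2 <= 1 + z.1 &
    z.1 - 1 <= h * z.2 /\ - z.1 - 1 <= h * z.2]].
  apply/seteqP; split => z.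
    move=> hz.
    have := hz (@Ordinal 6 0 isT); have := hz (@Ordinal 6 1 isT).
    have := hz (@Ordinal 6 2 isT); have := hz (@Ordinal 6 3 isT).
    have := hz (@Ordinal 6 4 isT); have := hz (@Ordinal 6 5 isT).
    by rewrite /hexnormal /dot /= -/h => ? ? ? ? ? ?; do ![split]; lra.
  move=> [? ? ? ? [? ?]] [[|[|[|[|[|[|//]]]]]] i] //=; rewrite /hexnormal /dot /= -/h; lra.
pose H1 := @hexQ R `&` [set z | 0 <= 0 + (-1) * z.1 + 0 * z.2].
pose H2 := @hexQ R `&` [set z | 0 < 0 + 1 * z.1 + 0 * z.2].
have mQ : measurable (@hexQ R).
  rewrite QE (_ : [set _ | _] =
    [set z | 0 <= 1 / 2 + 1 * z.1 + 0 * z.2] `&`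
    [set z | 0 <= 1 / 2 + (-1) * z.1 + 0 * z.2] `&`
    ([set z | 0 <= 1 + (-1) * z.1 + (- h) * z.2] `&`
     [set z | 0 <= 1 + 1 * z.1 + (- h) * z.2]) `&`
    ([set z | 0 <= 1 + (-1) * z.1 + h * z.2] `&`
     [set z | 0 <= 1 + 1 * z.1 + h * z.2])).
    by repeat (first [exact: measurable_halfplane_ge0 | apply: measurableI]).
  apply/seteqP; split => z /=; first by move=> [? ? ? ? [? ?]]; do ![split]; lra.
  by move=> [[[? ?] [? ?]] [? ?]]; do ![split]; lra.
have m1 : measurable H1 by apply: measurableI => //; exact: measurable_halfplane_ge0.
have m2 : measurable H2 by apply: measurableI => //; exact: measurable_halfplane_gt0.
have hE : 3 / h = h by rewrite -h2; field; rewrite gt_eqF.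
have sectE c : 0 < c -> lebesgue_measure (`[- (c / h), c / h]%classic : set R) =
    (2 * c / h)%:E.
  move=> c0; rewrite lebesgue_measure_itv /= lte_fin ifT; last first.
    by have : 0 < c / h by [exact: divr_gt0]; lra.
  by rewrite -EFinB; congr EFin; field; rewrite gt_eqF.
have a1 : area H1 = (h / 4)%:E.
  rewrite (@area_affine_sections _ _ (2 / h) (2 / h) (- (1 / 2)) 0) //.
  - by congr EFin; rewrite -[in RHS](hE); field; rewrite gt_eqF.
  - by move=> z; rewrite /H1 QE => -[[? ? ? ? [? ?]] /= ?]; apply/andP; split; lra.
  move=> x /andP[x0 x1].
  rewrite (_ : xsection _ _ = `[- ((1 + x) / h), (1 + x) / h]%classic).
    by rewrite sectE; [congr EFin; ring | lra].
  apply/seteqP; split => y; rewrite /xsection /H1 QE /= inE /= in_symmetric_itv //.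
    by move=> [[? ? ? ? [? ?]] _]; apply/andP; split; lra.
  by move=> /andP[? ?]; do ![split]; lra.
have a2 : area H2 = (h / 4)%:E.
  rewrite (@area_affine_sections _ _ (2 / h) (- (2 / h)) 0 (1 / 2)) //.
  - by congr EFin; rewrite -[in RHS](hE); field; rewrite gt_eqF.
  - by move=> z; rewrite /H2 QE => -[[? ? ? ? [? ?]] /= ?]; apply/andP; split; lra.
  move=> x /andP[x0 x1].
  rewrite (_ : xsection _ _ = `[- ((1 - x) / h), (1 - x) / h]%classic).
    by rewrite sectE; [congr EFin; ring | lra].
  apply/seteqP; split => y; rewrite /xsection /H2 QE /= inE /= in_symmetric_itv //.
    by move=> [[? ? ? ? [? ?]] _]; apply/andP; split; lra.
  by move=> /andP[? ?]; do ![split]; lra.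
rewrite (_ : @hexQ R = H1 `|` H2); last first.
  rewrite -setIUr; apply/esym/setIidPl => z _ /=.
  by have [?|?] := leP z.1 0; [left | right]; lra.
rewrite (_ : area _ = (area H1 + area H2)%E); last first.
  by apply: measureU => //; apply/seteqP; split => z //= -[[_ /= ?] [_ /= ?]]; lra.
by rewrite a1 a2 -EFinD; congr EFin; rewrite -/h; field.
Qed.

(** * Affine frames and packings by disjoint pieces *)

Definition lat {R : realType} (c f g z : R * R) : R * R :=
  (c.1 + z.1 * f.1 + z.2 * g.1, c.2 + z.1 * f.2 + z.2 * g.2).

(** Explicit weights make membership in convex sets and in half-planes accessible, in contrast to
    the side inequalities of [opentri]. *)
Definition bary {R : realType} (u v w : R * R) : set (R * R) :=
  [set z | exists a b c, [/\ 0 < a, 0 < b, 0 < c, a + b + c = 1 &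
     z = (a * u.1 + b * v.1 + c * w.1, a * u.2 + b * v.2 + c * w.2)]].

(* [K] and [W] live in the coordinates given by [lat c f g]; [x] is twice an area, in
   units of the parallelogram spanned by [f] and [g], so that triangles contribute
   their cross product. *)
Definition packs {R : realType} (c f g : R * R) (K W : set (R * R)) (x : R) :=
  exists U : set (R * R), [/\ measurable U, U `<=` lat c f g @` (K `&` W) &
    ((cross f g * x / 2)%:E <= area U)%E].

Lemma lat_inj (R : realType) (c f g : R * R) : 0 < cross f g -> injective (lat c f g).
Proof.
case: c f g => [c1 c2] [f1 f2] [g1 g2]; rewrite /cross /lat /= => k.
move=> [x y] [x' y'] /= [e1 e2]; have k0 := lt0r_neq0 k.
have h1 : (f1 * g2 - f2 * g1) * (x - x') = 0.
  rewrite (_ : _ * _ = g2 * ((c1 + x * f1 + y * g1) - (c1 + x' * f1 + y' * g1)) -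
    g1 * ((c2 + x * f2 + y * g2) - (c2 + x' * f2 + y' * g2))); last by ring.
  by rewrite e1 e2; ring.
have h2 : (f1 * g2 - f2 * g1) * (y - y') = 0.
  rewrite (_ : _ * _ = f1 * ((c2 + x * f2 + y * g2) - (c2 + x' * f2 + y' * g2)) -
    f2 * ((c1 + x * f1 + y * g1) - (c1 + x' * f1 + y' * g1))); last by ring.
  by rewrite e1 e2; ring.
move/eqP: h1; move/eqP: h2; rewrite !mulf_eq0 !(negbTE k0) /= !subr_eq0.
by move=> /eqP -> /eqP ->.
Qed.

(** The weights are the three cross products of [opentri], each assigned to the opposite vertex and
    divided by their sum [D]. *)
Lemma opentri_bary (R : realType) (u v w z : R * R) :
  opentri u v w z -> bary u v w z.
Proof.
case: u v w z => [u1 u2] [v1 v2] [w1 w2] [z1 z2] [].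
rewrite /cross /psub /= => h1 h2 h3.
pose D := (v1 - u1) * (w2 - u2) - (v2 - u2) * (w1 - u1).
have D0 : 0 < D by rewrite /D; lra.
have Dn := lt0r_neq0 D0.
exists (((w1 - v1) * (z2 - v2) - (w2 - v2) * (z1 - v1)) / D).
exists (((u1 - w1) * (z2 - w2) - (u2 - w2) * (z1 - w1)) / D).
exists (((v1 - u1) * (z2 - u2) - (v2 - u2) * (z1 - u1)) / D).
split; try exact: divr_gt0.
- by apply: (mulIf Dn); rewrite !mulrDl !divfK // /D; ring.
- by rewrite /=; congr (_, _); apply: (mulIf Dn);
    rewrite !mulrDl ![_ / D * _ * D]mulrAC !divfK // /D; ring.
Qed.

(** First [v] and [w] are combined with weights [b / (b + c)] and [c / (b + c)], then the result
    with [u]. *)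
Lemma convex_bary (R : realType) (K : set (R * R)) (u v w : R * R) :
  Defs.convex_set K -> K u -> K v -> K w -> bary u v w `<=` K.
Proof.
move=> cK Ku Kv Kw _ [a [b [c [a0 b0 c0 abc ->]]]].
have bc0 : 0 < b + c by lra.
have h : 0 <= b / (b + c) <= 1.
  apply/andP; split; first by apply: divr_ge0; exact: ltW.
  by rewrite ler_pdivrMr //; lra.
have := cK _ _ Ku (cK _ _ Kv Kw _ h) a; rewrite /padd /pscale /=.
have -> : 1 - a = b + c by lra.
have -> : 1 - b / (b + c) = c / (b + c) by field; rewrite gt_eqF.
have e (s t : R) : (b + c) * (b / (b + c) * s + c / (b + c) * t) = b * s + c * t.
  by field; rewrite gt_eqF.
by rewrite !e !addrA; apply; apply/andP; split; lra.
Qed.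

Section Packing.
Context {R : realType}.
Implicit Types (c f g u v w z : R * R) (K W : set (R * R)) (x y : R).

(** The empty set serves for every nonpositive signed area. Thus sums of signed areas can be used
    without discussing the shape of each piece. *)
Lemma packs0 c f g K W x : 0 < cross f g -> x <= 0 -> packs c f g K W x.
Proof.
move=> k0 x0; exists set0; split => //.
rewrite [area _]measure0 lee_fin; nra.
Qed.

Lemma packsW c f g K W W' x x' : 0 < cross f g -> W `<=` W' -> x' <= x ->
  packs c f g K W x -> packs c f g K W' x'.
Proof.
move=> k0 WW xx [U [mU UK aU]]; exists U; split => //.
  by move=> z /UK[z' [Kz' /WW Wz'] <-]; exists z'.
apply: le_trans aU; rewrite lee_fin; apply: ler_wpM2r; first lra.
by apply: ler_wpM2l => //; exact: ltW.
Qed.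

Lemma packsU c f g K W1 W2 x y : 0 < cross f g ->
  (forall z, W1 z -> W2 z -> False) ->
  packs c f g K W1 x -> packs c f g K W2 y ->
  packs c f g K (W1 `|` W2) (x + y).
Proof.
move=> k0 dis [U1 [m1 s1 a1]] [U2 [m2 s2 a2]]; exists (U1 `|` U2); split.
- exact: measurableU.
- move=> z [/s1|/s2] [z' [Kz Wz] <-]; exists z' => //; split => //; [by left | by right].
- rewrite (_ : area _ = (area U1 + area U2)%E); last first.
    apply: measureU => //; apply/seteqP; split => z //= -[/s1[z1 [_ W1z] <-]].
    by move=> /s2[z2 [_ W2z] /(lat_inj _ _ _ _ k0) zz]; subst z2; exact: (dis z1).
  by rewrite mulrDr mulrDl EFinD; exact: leeD.
Qed.

(** The map [lat c f g] multiplies cross products by [cross f g], and convexity keeps the open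
    triangle inside [K]. *)
Lemma packs_tri c f g K W u v w : 0 < cross f g -> Defs.convex_set K ->
  K u -> K v -> K w -> bary u v w `<=` W ->
  packs c f g K W (cross (psub v u) (psub w u)).
Proof.
move=> k0 cK Ku Kv Kw hW.
exists (opentri (lat c f g u) (lat c f g v) (lat c f g w)); split.
- exact: measurable_opentri.
- move=> z /opentri_bary[a [b [e [a0 b0 e0 abe ->]]]].
  pose z' := (a * u.1 + b * v.1 + e * w.1, a * u.2 + b * v.2 + e * w.2).
  have bz' : bary u v w z' by exists a, b, e.
  exists z'; first by split; [exact: (convex_bary _ _ u v w) | exact: hW].
  rewrite /lat /z' /=.
  by congr (_, _); rewrite -[X in X + _ + _]mul1r -abe; ring.
- apply: le_trans (area_opentri _ _ _ _); rewrite lee_fin le_eqVlt; apply/orP; left.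
  by apply/eqP; rewrite /lat /cross /psub /=; field.
Qed.

End Packing.

(** * Pieces of a convex set over the sides of an inscribed triangle *)

Section Triangles.
Context {R : realType}.
Implicit Types (c f g u v w z : R * R) (K W : set (R * R)).

Lemma baryE u v w (z1 z2 : R) : bary u v w (z1, z2) -> exists a b : R,
  [/\ 0 < a, 0 < b, 0 < 1 - a - b,
    z1 = a * u.1 + b * v.1 + (1 - a - b) * w.1 &
    z2 = a * u.2 + b * v.2 + (1 - a - b) * w.2].
Proof.
move=> [a [b [e [a0 b0 e0 abe [-> ->]]]]]; exists a, b.
by have <- : e = 1 - a - b by lra.
Qed.

(* [(a, b)] and [(c, e)] are the apexes of the caps over two sides of a triangle,
   relative to their common corner and measured by the heights over these sides; the
   last two equations express a common point of the caps. *)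
Lemma caps_disjoint (a b c e s t s' t' : R) :
  0 < s -> 0 < t -> 0 < s' -> 0 < t' -> c <= a -> b <= e ->
  0 < s * a -> 0 < s' * e -> s * a = s' * c - t' -> s * b - t = s' * e -> False.
Proof.
move=> s0 t0 s0' t0' ca be sa se e1 e2.
have a0 : 0 < a by rewrite -(pmulr_rgt0 _ s0).
have e0 : 0 < e by rewrite -(pmulr_rgt0 _ s0').
(* Comparing the heights over the first side gives [s < s'], over the second side [s' < s]. *)
have h1 : s * a < s' * a by apply: (@lt_le_trans _ _ (s' * c)); [lra | rewrite ler_pM2l].
have h2 : s' * e < s * e by apply: (@lt_le_trans _ _ (s * b)); [lra | rewrite ler_pM2l].
by move: h1 h2; rewrite !ltr_pM2r // => h1 h2; lra.
Qed.

(* Mixed area: the caps with apexes [X], [Y], [Z] over the sides of the inverted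
   triangle of side [2/3] have total area proportional to the size of the
   circumscribed triangle of the same orientation. *)
Lemma packs_caps c f g K o X Y Z : 0 < cross f g -> Defs.convex_set K ->
  K o -> K (o.1 - 2 / 3, o.2) -> K (o.1, o.2 - 2 / 3) -> K X -> K Y -> K Z ->
  o.1 <= X.1 -> Y.1 <= X.1 -> Z.1 <= X.1 ->
  o.2 <= Y.2 -> X.2 <= Y.2 -> Z.2 <= Y.2 ->
  Z.1 + Z.2 <= o.1 + o.2 - 2 / 3 -> Z.1 + Z.2 <= X.1 + X.2 -> Z.1 + Z.2 <= Y.1 + Y.2 ->
  2 <= X.1 + Y.2 - Z.1 - Z.2 -> packs c f g K setT (4 / 3).
Proof.
case: o X Y Z => [x1 x2] [X1 X2] [Y1 Y2] [Z1 Z2] /=.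
move=> k0 cK Ko Kp Kq KX KY KZ oX YX ZX oY XY ZY oZ XZ YZ s2.
(* The half-planes separate the caps from the inverted triangle [WD]; the caps are separated from
   each other by [caps_disjoint]. *)
pose WX := [set z : R * R | x1 < z.1] `&` bary (x1, x2 - 2 / 3) (X1, X2) (x1, x2).
pose WY := [set z : R * R | x2 < z.2] `&` bary (x1, x2) (Y1, Y2) (x1 - 2 / 3, x2).
pose WZ := [set z : R * R | z.1 + z.2 < x1 + x2 - 2 / 3] `&`
  bary (x1 - 2 / 3, x2) (Z1, Z2) (x1, x2 - 2 / 3).
pose WD := [set z : R * R | [/\ z.1 < x1, z.2 < x2 & x1 + x2 - 2 / 3 < z.1 + z.2]].
have pX : packs c f g K WX (2 / 3 * (X1 - x1)).
  move: oX; rewrite le_eqVlt => /predU1P[<-|oX]; first by apply: packs0 => //; lra.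
  rewrite (_ : _ * _ = cross (psub (X1, X2) (x1, x2 - 2 / 3)) (psub (x1, x2) (x1, x2 - 2 / 3))).
    apply: packs_tri => // z Bz; split => //; case: Bz => a [b [e [a0 b0 e0 abe ->]]] /=.
    have -> : a = 1 - b - e by lra.
    by nra.
  by rewrite /cross /psub /=; ring.
have pY : packs c f g K WY (2 / 3 * (Y2 - x2)).
  move: oY; rewrite le_eqVlt => /predU1P[<-|oY]; first by apply: packs0 => //; lra.
  rewrite (_ : _ * _ = cross (psub (Y1, Y2) (x1, x2)) (psub (x1 - 2 / 3, x2) (x1, x2))).
    apply: packs_tri => // z Bz; split => //; case: Bz => a [b [e [a0 b0 e0 abe ->]]] /=.
    have -> : a = 1 - b - e by lra.
    by nra.
  by rewrite /cross /psub /=; ring.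
have pZ : packs c f g K WZ (2 / 3 * (x1 + x2 - 2 / 3 - Z1 - Z2)).
  move: oZ; rewrite le_eqVlt => /predU1P[oZ|oZ]; first by apply: packs0 => //; lra.
  rewrite (_ : _ * _ = cross (psub (Z1, Z2) (x1 - 2 / 3, x2))
      (psub (x1, x2 - 2 / 3) (x1 - 2 / 3, x2))).
    apply: packs_tri => // z Bz; split => //; case: Bz => a [b [e [a0 b0 e0 abe ->]]] /=.
    have -> : a = 1 - b - e by lra.
    by nra.
  by rewrite /cross /psub /=; ring.
have pD : packs c f g K WD (4 / 9).
  rewrite (_ : 4 / 9 = cross (psub (x1 - 2 / 3, x2) (x1, x2)) (psub (x1, x2 - 2 / 3) (x1, x2))).
    apply: packs_tri => // _ [a [b [e [a0 b0 e0 abe ->]]]] /=.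
    have -> : a = 1 - b - e by lra.
    by split => /=; lra.
  by rewrite /cross /psub /=; field.
have dXY z : WX z -> WY z -> False.
  case: z => z1 z2 [/= h1 /baryE[a [b [a0 b0 e0 e1 e2]]]].
  move=> [/= h2 /baryE[a' [b' [a0' b0' e0' f1 f2]]]]; move: e1 e2 f1 f2 => /= e1 e2 f1 f2.
  (* [b] and [b'] are the weights of the apexes; the far corner of each side lies at depth [2 / 3]
     below the other side, which gives the terms subtracted. *)
  apply: (caps_disjoint (X1 - x1) (X2 - x2) (Y1 - x1) (Y2 - x2)
    b (a * (2 / 3)) b' ((1 - a' - b') * (2 / 3))); lra.
have dYZ z : WY z -> WZ z -> False.
  case: z => z1 z2 [/= h1 /baryE[a [b [a0 b0 e0 e1 e2]]]].
  move=> [/= h2 /baryE[a' [b' [a0' b0' e0' f1 f2]]]]; move: e1 e2 f1 f2 => /= e1 e2 f1 f2.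
  apply: (caps_disjoint (Y2 - x2) (x1 + x2 - 2 / 3 - Y1 - Y2)
    (Z2 - x2) (x1 + x2 - 2 / 3 - Z1 - Z2)
    b (a * (2 / 3)) b' ((1 - a' - b') * (2 / 3))); lra.
have dZX z : WZ z -> WX z -> False.
  case: z => z1 z2 [/= h1 /baryE[a [b [a0 b0 e0 e1 e2]]]].
  move=> [/= h2 /baryE[a' [b' [a0' b0' e0' f1 f2]]]]; move: e1 e2 f1 f2 => /= e1 e2 f1 f2.
  apply: (caps_disjoint (x1 + x2 - 2 / 3 - Z1 - Z2) (Z1 - x1)
    (x1 + x2 - 2 / 3 - X1 - X2) (X1 - x1)
    b (a * (2 / 3)) b' ((1 - a' - b') * (2 / 3))); lra.
have dDX z : WD z -> WX z -> False by move=> [/= ? ? ?] [/= ? _]; lra.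
have dDY z : WD z -> WY z -> False by move=> [/= ? ? ?] [/= ? _]; lra.
have dDZ z : WD z -> WZ z -> False by move=> [/= ? ? ?] [/= ? _]; lra.
have pDX := packsU _ _ _ _ _ _ _ _ k0 dDX pD pX.
have pDXY := packsU _ _ _ _ _ _ _ _ k0
  (fun z => [eta or_ind (dDY z) (dXY z)]) pDX pY.
have := packsU _ _ _ _ _ _ _ _ k0 (fun z => [eta or_ind
  (or_ind (dDZ z) (fun x y => dZX z y x)) (dYZ z)]) pDXY pZ.
(* The four pieces add up to exactly [2 / 3 * (X1 + Y2 - Z1 - Z2)]. *)
by apply: packsW => //; lra.
Qed.

End Triangles.

(* The part of [K] beyond the side of the inverted triangle from [o] to
   [o + (0, 2/3)]; [C] and [A] are relative to [o].  The bound is twice the signed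
   area of the quadrilateral [o], [o + C], [o + A], [o + (0, 2/3)], whatever its
   shape. *)
Lemma packs_side (R : realType) (c f g : R * R) (K : set (R * R)) (x1 x2 c1 c2 a1 a2 : R) :
  0 < cross f g -> Defs.convex_set K ->
  K (x1, x2) -> K (x1, x2 + 2 / 3) -> K (x1 + c1, x2 + c2) -> K (x1 + a1, x2 + a2) ->
  0 <= a1 + a2 -> 0 <= c1 + c2 -> c2 <= a2 -> a2 <= 2 / 3 ->
  (a1 < 0 -> c1 + c2 <= 2 / 3) ->
  packs c f g K [set z | x1 < z.1 /\ x1 + x2 <= z.1 + z.2]
    (c1 * a2 - c2 * a1 + 2 / 3 * a1).
Proof.
move=> k0 cK Ko Kr KC KA ha hc ca a3 neg.
set W := [set z | _].
(* [l] is positive to the left of the diagonal from [o] to [o + A], along which the quadrilateral is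
   cut. *)
pose l (z : R * R) := a1 * (z.2 - x2) - a2 * (z.1 - x1).
have Wl (s : R) : [set z | W z /\ 0 < s * l z] `<=` W by move=> z [].
have [a1n|a1p] := ltP a1 0; last first.
  have T1 : packs c f g K [set z | W z /\ 0 < 1 * l z] (2 / 3 * a1).
    move: a1p; rewrite le_eqVlt => /predU1P[<-|a1p]; first by apply: packs0 => //; lra.
    rewrite (_ : _ * a1 = cross (psub (x1 + a1, x2 + a2) (x1, x2))
        (psub (x1, x2 + 2 / 3) (x1, x2))); last by rewrite /cross /psub /=; ring.
    apply: packs_tri => // -[z1 z2] /baryE[a [b [a0 b0 e0 /= -> ->]]].
    have := mulr_gt0 b0 a1p; have := mulr_ge0 (ltW b0) ha => h1 h2.
    rewrite /l /=; split; first by split => /=; lra.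
    rewrite (_ : 1 * _ = (1 - a - b) * (2 / 3 * a1)); last by ring.
    by rewrite !mulr_gt0.
  (* For [c1 < 0] the triangle with the vertices [o], [o + C], [o + A] has negative signed area, and
     [T1] alone suffices. *)
  have [c1n|c1p] := ltP c1 0.
    by apply: packsW T1 => //; nra.
  have T2 : packs c f g K [set z | W z /\ 0 < (-1) * l z] (c1 * a2 - c2 * a1).
    have [D0|D0] := leP (c1 * a2 - c2 * a1) 0; first exact: packs0.
    rewrite (_ : _ - _ = cross (psub (x1 + c1, x2 + c2) (x1, x2))
        (psub (x1 + a1, x2 + a2) (x1, x2))); last by rewrite /cross /psub /=; ring.
    have pos : 0 < c1 \/ 0 < a1.
      have [?|?] := ltP 0 c1; [by left | right].
      rewrite lt_neqAle a1p andbT; apply/eqP => a10.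
      have c10 : c1 = 0 by lra.
      by move: D0; rewrite -a10 c10; lra.
    apply: packs_tri => // -[z1 z2] /baryE[a [b [a0 b0 e0 /= -> ->]]].
    have := mulr_ge0 (ltW b0) hc; have := mulr_ge0 (ltW e0) ha => h1 h2.
    rewrite /l /=; split.
      split => /=; last by lra.
      have := mulr_ge0 (ltW b0) c1p; have := mulr_ge0 (ltW e0) a1p => h3 h4.
      by case: pos => pos; [have := mulr_gt0 b0 pos | have := mulr_gt0 e0 pos]; lra.
    rewrite (_ : -1 * _ = b * (c1 * a2 - c2 * a1)); last by ring.
    by rewrite mulr_gt0.
  apply: (packsW _ _ _ _ _ _ _ _ k0 _ _ (packsU _ _ _ _ _ _ _ _ k0 _ T2 T1)) => //.
    by move=> z [/Wl|/Wl].
  by move=> z [_ h1] [_ h2]; lra.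
(* Now [A] lies behind the side. If [C] does too, the bound is nonpositive; otherwise the triangle
   over the side with apex [C] alone reaches it. *)
have [c1n|c1p] := ltP c1 0.
  apply: packs0 => //; have := neg a1n => h.
  rewrite (_ : _ + _ = - (- c1 * (a1 + a2)) + a1 * (2 / 3 - (c1 + c2))); last by ring.
  by nra.
apply: (@packsW _ _ _ _ _ W W (2 / 3 * c1)) => //.
  rewrite -subr_ge0 (_ : _ - _ = c1 * (2 / 3 - a2) + (- a1) * (2 / 3 - c2)); last by ring.
  by rewrite addr_ge0 // mulr_ge0 //; lra.
move: c1p; rewrite le_eqVlt => /predU1P[<-|c1p]; first by apply: packs0 => //; lra.
rewrite (_ : _ * c1 = cross (psub (x1 + c1, x2 + c2) (x1, x2))
    (psub (x1, x2 + 2 / 3) (x1, x2))); last by rewrite /cross /psub /=; ring.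
apply: packs_tri => // -[z1 z2] /baryE[a [b [a0 b0 e0 /= -> ->]]].
have := mulr_gt0 b0 c1p; have := mulr_ge0 (ltW b0) hc => h1 h2.
by split => /=; lra.
Qed.

(* Three unit segments parallel to the sides, on the lines [z.2 = 0], [z.1 = 0] and
   [z.1 + z.2 = d], together with the inverted triangle with corner [(x0, y0)]. *)
Definition config {R : realType} (K : set (R * R)) (d y1 y2 y3 x0 y0 : R) : Prop :=
  [/\ K (1 - y1, 0) /\ K (- y1, 0), K (0, d + y2) /\ K (0, d - 1 + y2),
      K (d - 1 + y3, 1 - y3) /\ K (d + y3, - y3) &
      [/\ K (x0, y0), K (x0 - 2 / 3, y0) & K (x0, y0 - 2 / 3)]].

(* The symmetry of order 3 of the three lines and of the triangle. *)
Definition turn {R : realType} (d : R) (z : R * R) : R * R := (d - z.1 - z.2, z.1).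

(** * The order 3 symmetry acting on configurations and packings *)

(** The symmetry permutes cyclically the offsets and the numbers [x0], [y0], [d + 2 / 3 - x0 - y0],
    which locate the sides of the triangle relative to the three lines. *)
Lemma config_turn (R : realType) (K : set (R * R)) (d y1 y2 y3 x0 y0 : R) :
  config K d y1 y2 y3 x0 y0 ->
  config (K \o turn d) d y3 y1 y2 y0 (d + 2 / 3 - x0 - y0).
Proof.
move=> [[A A'] [B B'] [C C'] [Dr Dp Dq]]; rewrite /config /turn /=.
have e (z z' : R * R) : K z -> z = z' -> K z' by move=> + <-.
split; split; [ apply: (e _ _ C) | apply: (e _ _ C') | apply: (e _ _ A')
  | apply: (e _ _ A) | apply: (e _ _ B') | apply: (e _ _ B)
  | apply: (e _ _ Dp) | apply: (e _ _ Dq) | apply: (e _ _ Dr) ];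
  by congr (_, _); ring.
Qed.

Lemma convex_turn (R : realType) (K : set (R * R)) (d : R) :
  Defs.convex_set K -> Defs.convex_set (K \o turn d).
Proof.
move=> cK x y Kx Ky l h; have := cK _ _ Kx Ky l h.
by rewrite /turn /padd /pscale /=; congr (K _); congr (_, _); ring.
Qed.

Lemma cross_turn (R : realType) (f g : R * R) : cross (psub g f) (pscale (-1) f) = cross f g.
Proof. by rewrite /cross /psub /pscale /=; ring. Qed.

(** [lat c f g] after [turn d] is the frame with origin [c + d f] and basis [g - f], [- f], which
    has the same determinant. *)
Lemma packs_turn (R : realType) (c f g : R * R) (K W : set (R * R)) (d x : R) :
  packs (padd c (pscale d f)) (psub g f) (pscale (-1) f) (K \o turn d) (W \o turn d) x ->
  packs c f g K W x.
Proof.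
move=> [U [mU sU aU]]; exists U; split => //; last by rewrite cross_turn in aU.
move=> z /sU[z' [Kz' Wz'] <-]; exists (turn d z') => //.
by rewrite /lat /turn /padd /psub /pscale /=; congr (_, _); ring.
Qed.

Lemma seq_argmax (R : realType) (T : eqType) (f : T -> R) (a : T) (s : seq T) :
  exists2 x, x \in a :: s & forall y, y \in a :: s -> f y <= f x.
Proof.
elim: s a => [|b s IH] a; first by exists a; rewrite ?mem_head // => y /[1!inE] /eqP ->.
have [x xs hx] := IH b; have [ax|xa] := leP (f a) (f x).
  exists x; first by rewrite inE xs orbT.
  by move=> y; rewrite inE => /predU1P[->//|/hx].
exists a; first exact: mem_head.
by move=> y; rewrite inE => /predU1P[->//|/hx /le_trans]; apply; exact: ltW.
Qed.

Definition config_pts {R : realType} (d y1 y2 y3 x0 y0 : R) : seq (R * R) :=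
  [:: (x0, y0); (x0 - 2 / 3, y0); (x0, y0 - 2 / 3); (1 - y1, 0); (- y1, 0);
      (0, d + y2); (0, d - 1 + y2); (d - 1 + y3, 1 - y3); (d + y3, - y3)].

(** * Consequences of the mixed area bound, and the piece over one side *)

Section Config.
Context {R : realType}.
Implicit Types (c f g z : R * R) (K : set (R * R)) (d : R).

Lemma config_ptsP K d (y1 y2 y3 x0 y0 : R) z : config K d y1 y2 y3 x0 y0 ->
  z \in config_pts d y1 y2 y3 x0 y0 -> K z.
Proof.
move=> [[A A'] [B B'] [C C'] [Dr Dp Dq]].
by rewrite !inE => /or4P[/eqP->|/eqP->|/eqP->|/or4P[/eqP->|/eqP->|/eqP->|/or3P[]/eqP->]].
Qed.

(** The apexes for [packs_caps] are the points of the list that are extreme in the three directions;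
    their spread is at least that of [X], [Y], [Z]. *)
Lemma config_wide c f g K d (y1 y2 y3 x0 y0 : R) X Y Z :
  0 < cross f g -> Defs.convex_set K -> config K d y1 y2 y3 x0 y0 ->
  let s := config_pts d y1 y2 y3 x0 y0 in
  X \in s -> Y \in s -> Z \in s -> 2 <= X.1 + Y.2 - Z.1 - Z.2 ->
  packs c f g K setT (4 / 3).
Proof.
move=> k0 cK cfg s Xs Ys Zs h2.
have sK z : z \in s -> K z by exact: config_ptsP.
have [U Us hU] := seq_argmax R _ (fun z => z.1) (x0, y0) (behead s).
have [V Vs hV] := seq_argmax R _ (fun z => z.2) (x0, y0) (behead s).
have [W Ws hW] := seq_argmax R _ (fun z => - (z.1 + z.2)) (x0, y0) (behead s).
have so : (x0, y0) \in s by rewrite inE eqxx.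
have sp : (x0 - 2 / 3, y0) \in s by rewrite !inE eqxx !orbT.
have sq : (x0, y0 - 2 / 3) \in s by rewrite !inE eqxx !orbT.
have := hW _ sp; have := hW _ Us; have := hW _ Vs; have := hW _ Zs.
have := hV _ so; have := hV _ Us; have := hV _ Ws; have := hV _ Ys.
have := hU _ so; have := hU _ Vs; have := hU _ Ws; have := hU _ Xs.
move=> /= *.
by apply: (packs_caps c f g K (x0, y0) U V W) => //=; try exact: sK; lra.
Qed.

Lemma config_bounds c f g K d (y1 y2 y3 x0 y0 : R) :
  0 < cross f g -> Defs.convex_set K -> config K d y1 y2 y3 x0 y0 ->
  packs c f g K setT (4 / 3) \/
  [/\ 0 < y1 < 1 - d, 0 < y2 < 1 - d, 0 < y3 < 1 - d &
      1 - d < y1 + y2 + y3 < 2 * (1 - d)].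
Proof.
move=> k0 cK cfg; have [|N] := pselect (packs c f g K setT (4 / 3)); [by left | right].
have lt2 X Y Z : X \in config_pts d y1 y2 y3 x0 y0 -> Y \in config_pts d y1 y2 y3 x0 y0 ->
    Z \in config_pts d y1 y2 y3 x0 y0 -> X.1 + Y.2 - Z.1 - Z.2 < 2.
  move=> Xs Ys Zs; rewrite ltNge; apply/negP => h; apply: N.
  exact: (config_wide _ _ _ _ _ _ _ _ _ _ X Y Z k0 cK cfg).
have sA : (1 - y1, 0) \in config_pts d y1 y2 y3 x0 y0 by rewrite !inE eqxx !orbT.
have sA' : (- y1, 0) \in config_pts d y1 y2 y3 x0 y0 by rewrite !inE eqxx !orbT.
have sB : (0, d + y2) \in config_pts d y1 y2 y3 x0 y0 by rewrite !inE eqxx !orbT.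
have sB' : (0, d - 1 + y2) \in config_pts d y1 y2 y3 x0 y0 by rewrite !inE eqxx !orbT.
have sC : (d - 1 + y3, 1 - y3) \in config_pts d y1 y2 y3 x0 y0 by rewrite !inE eqxx !orbT.
have sC' : (d + y3, - y3) \in config_pts d y1 y2 y3 x0 y0 by rewrite !inE eqxx !orbT.
(* Each choice of three endpoints yields one of the eight inequalities; the first one, for example,
   reads [2 - y1 < 2]. *)
have := lt2 _ _ _ sA sB sB'; have := lt2 _ _ _ sC' sC sB'; have := lt2 _ _ _ sA sC sA'.
have := lt2 _ _ _ sC' sC sA'; have := lt2 _ _ _ sA sB sA'; have := lt2 _ _ _ sC' sB sB'.
have := lt2 _ _ _ sA sC sB'; have := lt2 _ _ _ sC' sB sA'.
by move=> /= *; split; apply/andP; split; lra.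
Qed.

(** This is [packs_side] with the endpoints [(d + y3, - y3)] and [(1 - y1, 0)] in the roles of [C]
    and [A]. If [A] is behind the side, then [d <= 1 - y1 < x0], which yields the extra condition on
    [C]. *)
Lemma config_side c f g K d (y1 y2 y3 x0 y0 : R) :
  0 < cross f g -> Defs.convex_set K -> config K d y1 y2 y3 x0 y0 ->
  0 <= y3 -> y1 <= 1 - d -> 0 <= x0 -> 0 <= y0 -> x0 + y0 <= d + 2 / 3 ->
  packs c f g K [set z | x0 < z.1 /\ x0 + y0 - 2 / 3 <= z.1 + z.2]
    ((d + y3 - x0) * (2 / 3 - y0) - (2 / 3 - y0 - y3) * (1 - y1 - x0) +
     2 / 3 * (1 - y1 - x0)).
Proof.
move=> k0 cK [[A _] _ [_ C'] [Dr _ Dq]] hy3 hy1 hx0 hy0 hr.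
have e (z z' : R * R) : K z -> z = z' -> K z' by move=> + <-.
have := @packs_side R c f g K x0 (y0 - 2 / 3) (d + y3 - x0) (2 / 3 - y0 - y3)
  (1 - y1 - x0) (2 / 3 - y0) k0 cK Dq _ _ _ _ _ _ _ _.
rewrite (_ : x0 + (y0 - 2 / 3) = x0 + y0 - 2 / 3); last by ring.
apply; try lra.
- by apply: (e _ _ Dr); congr (_, _); ring.
- by apply: (e _ _ C'); congr (_, _); ring.
- by apply: (e _ _ A); congr (_, _); ring.
Qed.

End Config.

(** * The two positions of the inverted triangle *)

Section ConfigPacks.
Context {R : realType}.
Implicit Types (c f g z : R * R) (K : set (R * R)) (d : R).

Lemma config_inner c f g K d (y1 y2 y3 x0 y0 : R) :
  0 < cross f g -> Defs.convex_set K -> config K d y1 y2 y3 x0 y0 ->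
  0 <= d -> 0 < y1 < 1 - d -> 0 < y2 < 1 - d -> 0 < y3 < 1 - d ->
  1 - d < y1 + y2 + y3 < 2 * (1 - d) ->
  0 <= x0 -> 0 <= y0 -> x0 + y0 <= d + 2 / 3 ->
  packs c f g K setT (4 / 3).
Proof.
move=> k0 cK cfg d0 /andP[y10 y11] /andP[y20 y21] /andP[y30 y31] /andP[Y0 Y1] hx hy hr.
set s := d + 2 / 3 - x0 - y0.
have cfg1 := config_turn _ _ _ _ _ _ _ _ cfg.
have cfg2 := config_turn _ _ _ _ _ _ _ _ cfg1.
have ck1 := convex_turn _ _ d cK; have ck2 := convex_turn _ _ d ck1.
have es : d + 2 / 3 - y0 - (d + 2 / 3 - x0 - y0) = x0 by ring.
rewrite es -/s in cfg1 cfg2.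
have k1 : 0 < cross (psub g f) (pscale (-1) f) by rewrite cross_turn.
have k2 : 0 < cross (psub (pscale (-1) f) (psub g f)) (pscale (-1) (psub g f)).
  by rewrite cross_turn.
have s0 : 0 <= s by rewrite /s; lra.
have sE : x0 + y0 + s = d + 2 / 3 by rewrite /s; ring.
have pX := config_side c _ _ _ _ _ _ _ _ _ k0 cK cfg (ltW y30) (ltW y11) hx hy hr.
have hr1 : y0 + s <= d + 2 / 3 by lra.
have pY := config_side (padd c (pscale d f)) _ _ _ _ _ _ _ _ _ k1 ck1 cfg1
  (ltW y20) (ltW y31) hy s0 hr1.
have hr2 : s + x0 <= d + 2 / 3 by lra.
have pZ := config_side (padd (padd c (pscale d f)) (pscale d (psub g f))) _ _ _ _ _ _ _ _ _
  k2 ck2 cfg2 (ltW y10) (ltW y21) s0 hx hr2.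
(* The complement of the triangle is divided like a pinwheel: each region is bounded by a side
   extended beyond one corner only. *)
pose WX := [set z : R * R | x0 < z.1 /\ x0 + y0 - 2 / 3 <= z.1 + z.2].
pose WY := [set z : R * R | y0 < z.2 /\ z.1 <= x0].
pose WZ := [set z : R * R | z.1 + z.2 < x0 + y0 - 2 / 3 /\ z.2 <= y0].
pose WD := [set z : R * R | [/\ z.1 < x0, z.2 < y0 & x0 + y0 - 2 / 3 < z.1 + z.2]].
have sY : [set z : R * R | y0 < z.1 /\ y0 + s - 2 / 3 <= z.1 + z.2] `<=` WY \o turn d.
  by move=> z [/= ? ?]; rewrite /WY /turn /=; split; lra.
have {}pY := packs_turn _ _ _ _ _ WY _ _ (packsW _ _ _ _ _ _ _ _ k1 sY (lexx _) pY).
have sZ : [set z : R * R | s < z.1 /\ s + x0 - 2 / 3 <= z.1 + z.2] `<=`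
    WZ \o turn d \o turn d.
  by move=> z [/= ? ?]; rewrite /WZ /turn /=; split; lra.
have {}pZ := packs_turn _ _ _ _ _ WZ _ _ (packs_turn _ _ _ _ _ (WZ \o turn d) _ _
  (packsW _ _ _ _ _ _ _ _ k2 sZ (lexx _) pZ)).
have pD : packs c f g K WD (4 / 9).
  have [_ _ _ [Dr Dp Dq]] := cfg.
  rewrite (_ : 4 / 9 = cross (psub (x0 - 2 / 3, y0) (x0, y0))
      (psub (x0, y0 - 2 / 3) (x0, y0))); last by rewrite /cross /psub /=; field.
  apply: packs_tri => // -[z1 z2] /baryE[a [b [a0 b0 e0 /= -> ->]]].
  by split => /=; lra.
have dXY z : WX z -> WY z -> False by move=> [/= ? ?] [/= ? ?]; lra.
have dYZ z : WY z -> WZ z -> False by move=> [/= ? ?] [/= ? ?]; lra.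
have dXZ z : WX z -> WZ z -> False by move=> [/= ? ?] [/= ? ?]; lra.
have dDX z : WD z -> WX z -> False by move=> [/= ? ? ?] [/= ? _]; lra.
have dDY z : WD z -> WY z -> False by move=> [/= ? ? ?] [/= ? _]; lra.
have dDZ z : WD z -> WZ z -> False by move=> [/= ? ? ?] [/= ? _]; lra.
have pDX := packsU _ _ _ _ _ _ _ _ k0 dDX pD pX.
have pDXY := packsU _ _ _ _ _ _ _ _ k0
  (fun z => [eta or_ind (dDY z) (dXY z)]) pDX pY.
have := packsU _ _ _ _ _ _ _ _ k0 (fun z => [eta or_ind
  (or_ind (dDZ z) (dXZ z)) (dYZ z)]) pDXY pZ.
apply: packsW => //.
(* In the total of the four pieces [x0] and [y0] cancel; the excess over [4 / 3] becomes a sum of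
   terms that the bounds on the offsets make nonnegative. *)
rewrite -subr_ge0 (_ : _ - _ = (1 - d) / 3 * (1 - (1 - d)) +
  (y1 + y2 + y3 - (1 - d)) * (2 * (1 - d) - (y1 + y2 + y3)) / 3 +
  ((y1 - y2) ^+ 2 + (y2 - y3) ^+ 2 + (y3 - y1) ^+ 2) / 6); last by rewrite /s; field.
have := sqr_ge0 (y1 - y2); have := sqr_ge0 (y2 - y3); have := sqr_ge0 (y3 - y1).
have : 0 <= (1 - d) / 3 * (1 - (1 - d)) by apply: mulr_ge0; lra.
have : 0 <= (y1 + y2 + y3 - (1 - d)) * (2 * (1 - d) - (y1 + y2 + y3)) / 3.
  by apply: divr_ge0 => //; apply: mulr_ge0; lra.
by lra.
Qed.

Lemma config_outer c f g K d (y1 y2 y3 x0 y0 : R) :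
  0 < cross f g -> Defs.convex_set K -> config K d y1 y2 y3 x0 y0 ->
  0 <= d -> 0 < y1 < 1 - d -> 0 < y2 < 1 - d -> 0 < y3 < 1 - d ->
  1 - d < y1 + y2 + y3 < 2 * (1 - d) -> x0 <= 0 ->
  packs c f g K setT (4 / 3).
Proof.
move=> k0 cK cfg d0 /andP[y10 y11] /andP[y20 y21] /andP[y30 y31] /andP[Y0 Y1] hx.
have [[A A'] [B B'] [C C'] [Dr Dp Dq]] := cfg.
have split_at W1 W2 x y : packs c f g K W1 x -> packs c f g K W2 y ->
    W1 `<=` [set z | 0 < z.1] -> W2 `<=` [set z | z.1 < 0] -> 4 / 3 <= x + y ->
    packs c f g K setT (4 / 3).
  move=> p1 p2 s1 s2 h.
  apply: (packsW _ _ _ _ _ _ _ _ k0 _ h (packsU _ _ _ _ _ _ _ _ k0 _ p1 p2)) => //.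
  by move=> z /s1 /= ? /s2 /= ?; lra.
have left : packs c f g K [set z | z.1 < 0] (2 / 3 - x0).
  rewrite (_ : _ - _ = cross (psub (x0 - 2 / 3, y0) (0, d + y2))
      (psub (0, d - 1 + y2) (0, d + y2))); last by rewrite /cross /psub /=; ring.
  apply: packs_tri => // -[z1 z2] /baryE[a [b [a0 b0 e0 /= e1 e2]]] /=.
  have : 0 < b * (2 / 3 - x0) by apply: mulr_gt0; lra.
  by lra.
have right (X : R * R) : K X -> 0 < X.1 -> packs c f g K [set z | 0 < z.1] X.1.
  move=> KX X0; rewrite [X in packs _ _ _ _ _ X](_ : _ = cross (psub X (0, d - 1 + y2))
      (psub (0, d + y2) (0, d - 1 + y2))); last by rewrite /cross /psub /=; ring.
  apply: packs_tri => // -[z1 z2] /baryE[a [b [a0 b0 e0 /= e1 e2]]] /=.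
  by have := mulr_gt0 b0 X0; lra.
(* An endpoint at height at least [2 / 3] right of the unit chord on [z.1 = 0], together with
   [left], gives total height at least [4 / 3]. *)
have [hA|hA] := leP (2 / 3) (1 - y1).
  by apply: (split_at _ _ _ _ (right _ A _) left) => //=; lra.
have [hC|hC] := leP (2 / 3) (d + y3).
  by apply: (split_at _ _ _ _ (right _ C' _) left) => //=; lra.
(* The hexagon of the endpoints is cut along [z.1 = 0], and its halves along the diagonals [l = 0]
   from [(0, d + y2)] to [(d + y3, - y3)] and [r = 0] from [(0, d - 1 + y2)] to
   [(d - 1 + y3, 1 - y3)]. *)
pose l (z : R * R) := (d + y3) * (z.2 - d - y2) + (y3 + d + y2) * z.1.
pose r (z : R * R) := (y3 - (1 - d)) * (z.2 - d + 1 - y2) - (2 - y3 - d - y2) * z.1.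
have R1 : packs c f g K [set z | 0 < z.1 /\ l z < 0] (d + y3).
  rewrite (_ : d + y3 = cross (psub (0, d - 1 + y2) (0, d + y2)) (psub (d + y3, - y3) (0, d + y2)));
    last by rewrite /cross /psub /=; ring.
  apply: packs_tri => // -[z1 z2] /baryE[a [b [a0 b0 e0 /= -> ->]]].
  have : 0 < (1 - a - b) * (d + y3) by apply: mulr_gt0; lra.
  have : 0 < b * (d + y3) by apply: mulr_gt0; lra.
  by rewrite /l /= => ? ?; split; lra.
have R2 : packs c f g K [set z | 0 < z.1 /\ 0 < l z] (l (1 - y1, 0)).
  have [D0|D0] := leP (l (1 - y1, 0)) 0; first exact: packs0.
  rewrite (_ : l _ = cross (psub (d + y3, - y3) (0, d + y2)) (psub (1 - y1, 0) (0, d + y2)));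
    last by rewrite /l /cross /psub /=; ring.
  apply: packs_tri => // -[z1 z2] /baryE[a [b [a0 b0 e0 /= -> ->]]].
  have : 0 < (1 - a - b) * (1 - y1) by apply: mulr_gt0; lra.
  have : 0 < b * (d + y3) by apply: mulr_gt0; lra.
  have := mulr_gt0 e0 D0.
  by rewrite /l /= => ? ? ?; split; lra.
have L1 : packs c f g K [set z | z.1 < 0 /\ r z < 0] (1 - d - y3).
  rewrite (_ : 1 - d - y3 = cross (psub (0, d + y2) (0, d - 1 + y2))
      (psub (d - 1 + y3, 1 - y3) (0, d - 1 + y2)));
    last by rewrite /cross /psub /=; ring.
  apply: packs_tri => // -[z1 z2] /baryE[a [b [a0 b0 e0 /= -> ->]]].
  have : 0 < (1 - a - b) * (1 - d - y3) by apply: mulr_gt0; lra.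
  have : 0 < b * (1 - d - y3) by apply: mulr_gt0; lra.
  by rewrite /r /= => ? ?; split; lra.
have L2 : packs c f g K [set z | z.1 < 0 /\ 0 < r z] (r (- y1, 0)).
  have [D0|D0] := leP (r (- y1, 0)) 0; first exact: packs0.
  rewrite (_ : r _ = cross (psub (d - 1 + y3, 1 - y3) (0, d - 1 + y2))
      (psub (- y1, 0) (0, d - 1 + y2)));
    last by rewrite /r /cross /psub /=; ring.
  apply: packs_tri => // -[z1 z2] /baryE[a [b [a0 b0 e0 /= -> ->]]].
  have : 0 < (1 - a - b) * y1 by apply: mulr_gt0; lra.
  have : 0 < b * (1 - d - y3) by apply: mulr_gt0; lra.
  have := mulr_gt0 e0 D0.
  by rewrite /r /= => ? ? ?; split; lra.
have dR z : (0 < z.1 /\ l z < 0) -> (0 < z.1 /\ 0 < l z) -> False.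
  by move=> [_ ?] [_ ?]; lra.
have dL z : (z.1 < 0 /\ r z < 0) -> (z.1 < 0 /\ 0 < r z) -> False.
  by move=> [_ ?] [_ ?]; lra.
apply: (split_at _ _ _ _ (packsU _ _ _ _ _ _ _ _ k0 dR R1 R2)
  (packsU _ _ _ _ _ _ _ _ k0 dL L1 L2)).
- by move=> z [[]|[]].
- by move=> z [[]|[]].
pose m := 1 - d; pose Y := y1 + y2 + y3.
have mE : m = 1 - d by []; have YE : Y = y1 + y2 + y3 by [].
pose psi := m * Y - (y1 * y2 + y2 * y3 + y3 * y1).
have -> : d + y3 + l (1 - y1, 0) + (1 - d - y3 + r (- y1, 0)) =
    1 + m - 2 * m ^+ 2 + 2 * psi.
  by rewrite /l /r /psi /m /Y /=; ring.
(* With [2 / 3 * m ^+ 2 <= psi] the claim becomes [(m - 1 / 2) * (1 - m) >= 0]. For smaller [m] the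
   bound [m / 3 <= psi] takes over; there [1 / 3 < y1 < m] by [hA]. *)
have [m2|m2] := leP (1 / 2) m.
  have : 2 / 3 * m ^+ 2 <= psi.
    rewrite -subr_ge0 (_ : _ - _ = (Y - m) * (2 * m - Y) / 3 +
      ((y1 - y2) ^+ 2 + (y2 - y3) ^+ 2 + (y3 - y1) ^+ 2) / 6); last first.
      by rewrite /psi /Y; field.
    have := sqr_ge0 (y1 - y2); have := sqr_ge0 (y2 - y3); have := sqr_ge0 (y3 - y1).
    have : 0 <= (Y - m) * (2 * m - Y) / 3.
      by apply: divr_ge0 => //; apply: mulr_ge0; lra.
    by lra.
  have : 0 <= (m - 1 / 2) * (1 - m) by apply: mulr_ge0; lra.
  by lra.
have ym : m / 3 <= psi.
  (* [psi] is affine in [y2] *)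
  have psiE : m * psi = (m - y2) * (m * y1 + y3 * (m - y1)) + y2 * (m * m - y1 * y3).
    by rewrite /psi /Y; ring.
  have h1 : m / 3 <= m * y1 + y3 * (m - y1).
    have : 0 <= y3 * (m - y1) by apply: mulr_ge0; lra.
    have : 0 <= m * (y1 - 1 / 3) by apply: mulr_ge0; lra.
    by lra.
  have h2 : m / 3 <= m * m - y1 * y3.
    have : 0 <= (m - y1) * y3 by apply: mulr_ge0; lra.
    have : 0 <= m * (m - 1 / 3 - y3) by apply: mulr_ge0; lra.
    by lra.
  have m0 : 0 < m by lra.
  rewrite -(ler_pM2l m0) psiE.
  have : 0 <= (m - y2) * (m * y1 + y3 * (m - y1) - m / 3).
    by apply: mulr_ge0; lra.
  have : 0 <= y2 * (m * m - y1 * y3 - m / 3).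
    by apply: mulr_ge0; lra.
  by lra.
have : 0 <= (m - 1 / 3) * (1 / 2 - m) by apply: mulr_ge0; lra.
by lra.
Qed.

End ConfigPacks.

(** * From three segments and one triangle in general position to a configuration *)

Section Main.
Context {R : realType}.
Implicit Types (c f g z : R * R) (K : set (R * R)) (d : R).

(** If one of the three position parameters of the triangle is nonpositive, at most two turns make
    it the first one, as [config_outer] requires; otherwise [config_inner] applies. *)
Lemma config_packs c f g K d (y1 y2 y3 x0 y0 : R) :
  0 < cross f g -> Defs.convex_set K -> config K d y1 y2 y3 x0 y0 ->
  0 <= d -> packs c f g K setT (4 / 3).
Proof.
move=> k0 cK cfg d0.
have [//|[h1 h2 h3 h4]] := config_bounds c _ _ _ _ _ _ _ _ _ k0 cK cfg.
have [hx|hx] := leP x0 0; first exact: (config_outer c _ _ _ _ _ _ _ _ _ k0 cK cfg d0).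
have cfg1 := config_turn _ _ _ _ _ _ _ _ cfg.
have ck1 := convex_turn _ _ d cK.
have k1 : 0 < cross (psub g f) (pscale (-1) f) by rewrite cross_turn.
have h4' : 1 - d < y3 + y1 + y2 < 2 * (1 - d).
  by rewrite (_ : _ + y2 = y1 + y2 + y3) //; ring.
have [hy|hy] := leP y0 0.
  by apply: (packs_turn _ _ _ _ _ _ d); exact: (config_outer _ _ _ _ _ _ _ _ _ _ k1 ck1 cfg1 d0).
have cfg2 := config_turn _ _ _ _ _ _ _ _ cfg1.
have ck2 := convex_turn _ _ d ck1.
have k2 : 0 < cross (psub (pscale (-1) f) (psub g f)) (pscale (-1) (psub g f)).
  by rewrite cross_turn.
have h4'' : 1 - d < y2 + y3 + y1 < 2 * (1 - d).
  by rewrite (_ : _ + y1 = y1 + y2 + y3) //; ring.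
have [hr|hr] := leP (d + 2 / 3 - x0 - y0) 0.
  apply: (packs_turn _ _ _ _ _ _ d); apply: (packs_turn _ _ _ _ _ _ d).
  exact: (config_outer _ _ _ _ _ _ _ _ _ _ k2 ck2 cfg2 d0).
by apply: (config_inner c _ _ _ _ _ _ _ _ _ k0 cK cfg d0) => //; lra.
Qed.

(** A translation puts the first two segments on the axes. The third then lies on [z.1 + z.2 = d]
    with [d = e.1 + e.2 - b.1 - a.2], nonnegative by the last hypothesis. *)
Lemma lattice_cover_packs c f g K (a b e o : R * R) :
  0 < cross f g -> Defs.convex_set K ->
  K a -> K (a.1 + 1, a.2) -> K b -> K (b.1, b.2 + 1) -> K e -> K (e.1 - 1, e.2 + 1) ->
  K o -> K (o.1 - 2 / 3, o.2) -> K (o.1, o.2 - 2 / 3) ->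
  b.1 + a.2 <= e.1 + e.2 -> packs c f g K setT (4 / 3).
Proof.
case: a b e o => [a1 a2] [b1 b2] [e1 e2] [t1 t2] /=.
move=> k0 cK Ka Ka' Kb Kb' Ke Ke' Ko Kp Kq hd.
pose sh (z : R * R) : R * R := (b1 + z.1, a2 + z.2).
have P : packs (lat c f g (b1, a2)) f g (K \o sh) setT (4 / 3).
  have E (z z' : R * R) : K z -> z = z' -> K z' by move=> + <-.
  apply: (@config_packs _ _ _ _ (e1 + e2 - b1 - a2) (b1 - a1) (b2 + 1 - a2 - (e1 + e2 - b1 - a2))
    (a2 - e2) (t1 - b1) (t2 - a2)) => //; last by lra.
    move=> x y Kx Ky l h; have := cK _ _ Kx Ky l h.
    by rewrite /sh /padd /pscale /=; congr (K _); congr (_, _); ring.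
  rewrite /config /sh /=; split; split;
    [ apply: (E _ _ Ka') | apply: (E _ _ Ka) | apply: (E _ _ Kb') | apply: (E _ _ Kb)
    | apply: (E _ _ Ke') | apply: (E _ _ Ke) | apply: (E _ _ Ko) | apply: (E _ _ Kp)
    | apply: (E _ _ Kq)]; by congr (_, _); ring.
have [U [mU sU aU]] := P; exists U; split => // z /sU[z' [Kz' _] <-]; exists (sh z') => //.
by rewrite /lat /sh /=; congr (_, _); ring.
Qed.

End Main.

(** * The norm of the hexagon, and what a cover must contain *)

Section Hexagon.
Context {R : realType}.
Local Notation h := (Num.sqrt 3 : R).

Lemma sqr_sqrt3 : h ^+ 2 = 3. Proof. by rewrite sqr_sqrtr. Qed.

Lemma sqrt3_gt0 : 0 < h. Proof. by rewrite sqrtr_gt0. Qed.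

Lemma dot_hexnormal_le1 (k j : 'I_6) : dot (hexnormal R k) (hexnormal R j) <= 1.
Proof.
have s2 := sqr_sqrt3.
case: k => [[|[|[|[|[|[|//]]]]]] ?]; case: j => [[|[|[|[|[|[|//]]]]]] ?];
  by rewrite /dot /hexnormal /=; lra.
Qed.

Lemma dot_hexnormal (k : 'I_6) : dot (hexnormal R k) (hexnormal R k) = 1.
Proof.
have s2 := sqr_sqrt3.
by case: k => [[|[|[|[|[|[|//]]]]]] ?]; rewrite /dot /hexnormal /=; lra.
Qed.

(** The supremum is attained at the midpoint of the side with normal [k], at distance [1 / 2] from
    the origin. *)
Lemma normQ_hexnormal (k : 'I_6) (t : R) : 0 < t ->
  normQ (pscale t (hexnormal R k)) = t / 2.
Proof.
move=> t0; rewrite /normQ.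
have ubQ : ubound [set dot (pscale t (hexnormal R k)) y | y in @hexQ R] (t / 2).
  move=> _ [y hy <-]; rewrite (_ : dot _ _ = t * dot y (hexnormal R k)).
    by have := ler_wpM2l (ltW t0) (hy k); lra.
  by rewrite /dot /pscale /=; ring.
have Qt : [set dot (pscale t (hexnormal R k)) y | y in @hexQ R] (t / 2).
  exists (pscale (1 / 2) (hexnormal R k)).
    move=> j; have := dot_hexnormal_le1 k j.
    by rewrite /dot /pscale /=; lra.
  transitivity (t / 2 * dot (hexnormal R k) (hexnormal R k)).
    by rewrite /dot /pscale /=; ring.
  by rewrite dot_hexnormal mulr1.
apply/eqP; rewrite eq_le; apply/andP; split.
  by apply: ge_sup => //; exists (t / 2).
by apply: ub_le_sup => //; exists (t / 2).
Qed.

Lemma normal_dir_hexnormal (k : 'I_6) (t : R) : 0 < t ->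
  normal_dir (pscale t (hexnormal R k)).
Proof. by move=> t0; exists k, t. Qed.

Lemma cover_seg (K : set (R * R)) (k k' : 'I_6) :
  Qcover K -> hexnormal R k' = pscale (-1) (hexnormal R k) ->
  exists p, K p /\ K (padd p (hexnormal R k)).
Proof.
move=> [_ fitK] kk'.
have e1 : psub (hexnormal R k) (0, 0) = pscale 1 (hexnormal R k).
  by rewrite /psub /pscale /= !subr0 !mul1r.
have e2 : psub (0, 0) (hexnormal R k) = pscale 1 (hexnormal R k').
  by rewrite kk' /psub /pscale /= !sub0r !mul1r !mulN1r.
have [|t ft] := fitK (seg (0, 0) (hexnormal R k)).
  right; exists (0, 0), (hexnormal R k); rewrite e1 e2; split => //.
  - exact: normal_dir_hexnormal.
  - exact: normal_dir_hexnormal.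
  - by rewrite !normQ_hexnormal //; field.
exists t; split.
  have := ft (0, 0); rewrite /padd /= !add0r; case: t {ft} => t1 t2; apply.
  by exists 1, 0; split => //; [ring | rewrite /padd /pscale /=; congr (_, _); ring].
have := ft (hexnormal R k); rewrite /padd /= addrC [t.2 + _]addrC; apply.
exists 0, 1; split => //; first by ring.
by case: hexnormal => u1 u2; rewrite /padd /pscale /=; congr (_, _); ring.
Qed.

(** [j] and [j'] index the directions of the other two sides; at side [2 / 3] each side has norm
    [1 / 3]. *)
Lemma cover_tri (K : set (R * R)) (k k' j j' : 'I_6) :
  Qcover K -> cross (hexnormal R k) (hexnormal R k') != 0 ->
  psub (hexnormal R k') (hexnormal R k) = hexnormal R j ->
  hexnormal R j' = pscale (-1) (hexnormal R k') ->
  exists p, [/\ K p, K (padd p (pscale (2 / 3) (hexnormal R k))) &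
    K (padd p (pscale (2 / 3) (hexnormal R k')))].
Proof.
move=> [_ fitK] kk' ej ej'.
set v := pscale (2 / 3) (hexnormal R k); set w := pscale (2 / 3) (hexnormal R k').
have e1 : psub v (0, 0) = v by case: v => v1 v2; rewrite /psub /= !subr0.
have e2 : psub w v = pscale (2 / 3) (hexnormal R j).
  by rewrite -ej /psub /v /w /pscale /= !mulrBr.
have e3 : psub (0, 0) w = pscale (2 / 3) (hexnormal R j').
  by rewrite ej' /psub /w /pscale /=; congr (_, _); ring.
have t0 : 0 < 2 / 3 :> R by lra.
have [|t ft] := fitK (tri (0, 0) v w).
  left; exists (0, 0), v, w; split.
  - split => //; rewrite (_ : cross _ _ = 4 / 9 * cross (hexnormal R k) (hexnormal R k')).
      by rewrite mulf_neq0 // lt0r_neq0 //; lra.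
    by rewrite /cross /psub /v /w /pscale /=; field.
  - by rewrite e1; exact: normal_dir_hexnormal.
  - by rewrite e2; exact: normal_dir_hexnormal.
  - by rewrite e3; exact: normal_dir_hexnormal.
  - by rewrite e1 e2 e3 !normQ_hexnormal //; field.
have fit (a b c : R) (z : R * R) : 0 <= a -> 0 <= b -> 0 <= c -> a + b + c = 1 ->
    z = padd t (padd (padd (pscale a (0, 0)) (pscale b v)) (pscale c w)) -> K z.
  move=> a0 b0 c0 abc ->; set z0 := padd (padd _ _) _.
  rewrite (_ : padd t z0 = padd z0 t); first by apply: ft; exists a, b, c.
  by rewrite /padd addrC [z0.2 + _]addrC.
move: v w {e1 e2 e3 ft} fit => [v1 v2] [w1 w2] fit; exists t; split.
- apply: (fit 1 0 0) => //; [ring | case: t {fit} => t1 t2].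
  by rewrite /padd /pscale /=; congr (_, _); ring.
- apply: (fit 0 1 0) => //; [ring |].
  by rewrite /padd /pscale /=; congr (_, _); ring.
- apply: (fit 0 0 1) => //; [ring |].
  by rewrite /padd /pscale /=; congr (_, _); ring.
Qed.

Lemma packs_le_area (K : set (R * R)) (c f g : R * R) (x : R) :
  closed K -> packs c f g (K \o lat c f g) setT x ->
  ((cross f g * x / 2)%:E <= area K)%E.
Proof.
move=> cK [U [mU sU aU]]; apply: le_trans aU _; apply: le_area => //.
by move=> z /sU[z' [Kz' _] <-].
Qed.

Lemma convex_lat (K : set (R * R)) (c f g : R * R) :
  Defs.convex_set K -> Defs.convex_set (K \o lat c f g).
Proof.
move=> cK x y Kx Ky l hl; have := cK _ _ Kx Ky l hl.
by rewrite /lat /padd /pscale /=; congr (K _); congr (_, _); ring.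
Qed.

End Hexagon.

Theorem theorem7p2 (R : realType) (K : set (R * R)) :
  Qcover K ->
  (area (@K0 R) <= area K)%E /\
  area (@K0 R) = ((2 * fine (area (@hexQ R)))^-1)%:E.
Proof.
move=> cov; rewrite area_K0 area_hexQ /=; split; last first.
  by congr EFin; congr (_^-1); field.
set h : R := Num.sqrt 3; have h2 : h ^+ 2 = 3 by exact: sqr_sqrt3.
have h0 : 0 < h by exact: sqrt3_gt0.
have hn0 := lt0r_neq0 h0.
have [[cK kK _] _] := cov.
have clK : closed K by apply: compact_closed => //; exact: norm_hausdorff.
pose O6 i (hi : (i < 6)%N) := Ordinal hi.
have [a [Ka Ka']] := cover_seg K (O6 0%N isT) (O6 3%N isT) cov
  ltac:(by rewrite /hexnormal /pscale /=; congr (_, _); ring).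
have [b [Kb Kb']] := cover_seg K (O6 1%N isT) (O6 4%N isT) cov
  ltac:(by rewrite /hexnormal /pscale /=; congr (_, _); ring).
have [e [Ke Ke']] := cover_seg K (O6 2%N isT) (O6 5%N isT) cov
  ltac:(by rewrite /hexnormal /pscale /=; congr (_, _); ring).
have n01 : cross (hexnormal R (O6 0%N isT)) (hexnormal R (O6 1%N isT)) != 0.
  by rewrite /cross /hexnormal /= mul1r mul0r subr0 mulf_neq0 // invr_neq0 // pnatr_eq0.
have n34 : cross (hexnormal R (O6 3%N isT)) (hexnormal R (O6 4%N isT)) != 0.
  rewrite (_ : cross _ _ = cross (hexnormal R (O6 0%N isT)) (hexnormal R (O6 1%N isT))) //.
  by rewrite /cross /hexnormal /=; ring.
have [p [Kp Kp1 Kp2]] := cover_tri K _ _ (O6 2%N isT) (O6 4%N isT) cov n01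
  ltac:(by rewrite /hexnormal /psub /=; congr (_, _); field)
  ltac:(by rewrite /hexnormal /pscale /=; congr (_, _); ring).
have [q [Kq Kq1 Kq2]] := cover_tri K _ _ (O6 5%N isT) (O6 1%N isT) cov n34
  ltac:(by rewrite /hexnormal /psub /=; congr (_, _); field)
  ltac:(by rewrite /hexnormal /pscale /=; congr (_, _); ring).
(* In the basis [(1, 0)], [g] the normals of index 0, 1, 2 have the coordinates [(1, 0)], [(0, 1)],
   [(- 1, 1)]. *)
pose g : R * R := (1 / 2, h / 2).
have k0 : 0 < cross (1, 0) g by rewrite /cross /g /=; lra.
have k0' : 0 < cross (-1, 0) (pscale (-1) g) by rewrite /cross /pscale /g /=; lra.
have surj (z : R * R) : exists z', z = lat (0, 0) (1, 0) g z'.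
  exists (z.1 - z.2 / h, 2 * z.2 / h); case: z => z1 z2; rewrite /lat /g /=.
  by congr (_, _); field.
have E (z z' : R * R) : K z -> z = z' -> K z' by move=> + <-.
have area_ge (f1 g1 : R * R) : cross f1 g1 = h / 2 ->
    packs (0, 0) f1 g1 (K \o lat (0, 0) f1 g1) setT (4 / 3) ->
    ((h^-1)%:E <= area K)%E.
  (* The area obtained is [h / 2 * (4 / 3) / 2 = h / 3], which is [h^-1] because [h ^+ 2 = 3]. *)
  move=> fg /(packs_le_area _ _ _ _ _ clK); rewrite fg; apply: le_trans.
  rewrite lee_fin -(ler_pM2l h0) mulfV //.
  by have := h2; lra.
have [a' ea] := surj a; have [b' eb] := surj b; have [e' ee] := surj e.
have [p' ep] := surj p; have [q' eq] := surj q.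
(* The sign of [d] decides between the triangle at [q] and, after the point reflection, the one at
   [p]. The reflection also exchanges the endpoints of each segment. *)
have [le|/ltW le] := leP (b'.1 + a'.2) (e'.1 + e'.2).
- apply: (area_ge (1, 0) g); first by rewrite /cross /g /=; ring.
  apply: (lattice_cover_packs _ _ _ _ a' b' e' q') => //; first exact: convex_lat.
  + by rewrite /= -ea.
  + by apply: (E _ _ Ka'); rewrite ea /lat /padd /g /hexnormal /= -/h; congr (_, _); field.
  + by rewrite /= -eb.
  + by apply: (E _ _ Kb'); rewrite eb /lat /padd /g /hexnormal /= -/h; congr (_, _); field.
  + by rewrite /= -ee.
  + by apply: (E _ _ Ke'); rewrite ee /lat /padd /g /hexnormal /= -/h; congr (_, _); field.
  + by rewrite /= -eq.
  + by apply: (E _ _ Kq1); rewrite eq /lat /padd /pscale /g /hexnormal /= -/h; congr (_, _); field.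
  + by apply: (E _ _ Kq2); rewrite eq /lat /padd /pscale /g /hexnormal /= -/h; congr (_, _); field.
- apply: (area_ge (-1, 0) (pscale (-1) g)); first by rewrite /cross /pscale /g /=; ring.
  apply: (lattice_cover_packs _ _ _ _ (- a'.1 - 1, - a'.2) (- b'.1, - b'.2 - 1)
    (- e'.1 + 1, - e'.2 - 1) (- p'.1, - p'.2)) => //=; first exact: convex_lat.
  + by apply: (E _ _ Ka'); rewrite ea /lat /padd /pscale /g /hexnormal /= -/h; congr (_, _); field.
  + by apply: (E _ _ Ka); rewrite ea /lat /padd /pscale /g /hexnormal /= -/h; congr (_, _); field.
  + by apply: (E _ _ Kb'); rewrite eb /lat /padd /pscale /g /hexnormal /= -/h; congr (_, _); field.
  + by apply: (E _ _ Kb); rewrite eb /lat /padd /pscale /g /hexnormal /= -/h; congr (_, _); field.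
  + by apply: (E _ _ Ke'); rewrite ee /lat /padd /pscale /g /hexnormal /= -/h; congr (_, _); field.
  + by apply: (E _ _ Ke); rewrite ee /lat /padd /pscale /g /hexnormal /= -/h; congr (_, _); field.
  + by apply: (E _ _ Kp); rewrite ep /lat /padd /pscale /g /hexnormal /= -/h; congr (_, _); field.
  + by apply: (E _ _ Kp1); rewrite ep /lat /padd /pscale /g /hexnormal /= -/h; congr (_, _); field.
  + by apply: (E _ _ Kp2); rewrite ep /lat /padd /pscale /g /hexnormal /= -/h; congr (_, _); field.
  + by lra.
Qed.
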